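(* Let $R$ be a reduced irreducible finite root system. Then $\mathcal M_c=\mathcal M_m=\mathcal M_r$.
   Context: Finite root systems contain $0$; $R^\times=R\setminus\{0\}$. Let $\mathcal W$ be the Weyl group of $R$, generated by the reflections $w_\alpha$, $\alpha\in R^\times$; for $P\subseteq R^\times$ let $\mathcal W_P$ be the subgroup generated by $w_\alpha$, $\alpha\in P$. $\mathcal M_r$ is the class of reflectable bases: subsets $P\subseteq R^\times$ with $\mathcal W_PP=R^\times$ such that no proper subset $P'$ of $P$ satisfies $\mathcal W_{P'}P'=R^\times$. $\mathcal M_m$ is the class of $P\subseteq R^\times$ that are minimal under inclusion with respect to $\mathcal W_P=\mathcal W$. $\mathcal M_c$ is the class of $P\subseteq R^\times$ with $\mathcal W_P=\mathcal W$ and $|P|=c$, where $c$ is the least number of reflections $w_\alpha$ ($\alpha\in R^\times$) generating $\mathcal W$. *)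

(* Defs.v *)
From HB Require Import structures.
From mathcomp Require Import all_boot all_order all_algebra.
From mathcomp Require Import finmap boolp classical_sets.

Set Implicit Arguments.
Unset Strict Implicit.
Unset Printing Implicit Defensive.

Import GRing.Theory.

Local Open Scope ring_scope.
Local Open Scope fset_scope.
Local Open Scope classical_set_scope.

(* [coroot a] is meaningful only for a nonzero root [a]; over a field of
   characteristic 0 it is then determined by [roots], so that carrying the
   coroots as data does not change the notion of a root system. *)
Record root_system (F : fieldType) (V : vectType F) := RootSystem {
  roots : {fset V};
  coroot : V -> {scalar V};
  root0 : 0 \in roots;
  roots_span : <<enum_fset roots>>%VS = fullv;
  coroot_root : forall a, a \in roots -> a != 0 -> coroot a a = 2%:R;
  root_refl : forall a b, a \in roots -> a != 0 -> b \in roots ->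
    b - coroot a b *: a \in roots;
  coroot_int : forall a b, a \in roots -> a != 0 -> b \in roots ->
    exists z : int, coroot a b = z%:~R
}.

Section RootSystem.
Variables (F : fieldType) (V : vectType F) (R : root_system V).
Implicit Types (P Q : {fset V}) (a b : V).

Definition nzroots : {fset V} := (roots R `\ 0)%fset.

Definition reduced : Prop :=
  forall a (k : F), a \in nzroots -> k *: a \in nzroots -> k = 1 \/ k = -1.

Definition orthogonal_roots a b : Prop := coroot R a b = 0 /\ coroot R b a = 0.

(* The zero system {0} is not excluded. *)
Definition irreducible : Prop :=
  forall P Q, (P `|` Q)%fset = nzroots -> [disjoint P & Q]%fset ->
    (forall a b, a \in P -> b \in Q -> orthogonal_roots a b) ->
  P = fset0 \/ Q = fset0.

Definition reflection a : 'End(V) := linfun (fun x => x - coroot R a x *: a).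

Definition reflections P : set 'End(V) := [set reflection a | a in [set` P]].

(* [lker f == 0] says that [f] is invertible, [f^-1] being then its inverse. *)
Definition is_subgroup (H : set 'End(V)) : Prop :=
  [/\ H \1%VF,
      forall f, H f -> lker f == 0%VS,
      forall f g, H f -> H g -> H (f \o g)%VF &
      forall f, H f -> H (f^-1)%VF].

Definition generated (S : set 'End(V)) : set 'End(V) := smallest is_subgroup S.

Definition weyl_sub P : set 'End(V) := generated (reflections P).

Definition weyl : set 'End(V) := weyl_sub nzroots.

Definition weyl_orbit P : set V := [set w p | w in weyl_sub P & p in [set` P]].

Definition reflectable_bases : set {fset V} :=
  [set P | [/\ (P `<=` nzroots)%fset,
               weyl_orbit P = [set` nzroots] &
               forall P', (P' `<` P)%fset -> weyl_orbit P' <> [set` nzroots]]].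

Definition minimal_generating : set {fset V} :=
  [set P | [/\ (P `<=` nzroots)%fset,
               weyl_sub P = weyl &
               forall P', (P' `<` P)%fset -> weyl_sub P' <> weyl]].

Definition generated_by_reflections (n : nat) : Prop :=
  exists S : {fset 'End(V)},
    [/\ [set` S] `<=` reflections nzroots, #|` S| = n & generated [set` S] = weyl].

Definition least_reflection_number (c : nat) : Prop :=
  generated_by_reflections c /\
  forall n, generated_by_reflections n -> (c <= n)%N.

Definition minimum_generating : set {fset V} :=
  [set P | [/\ (P `<=` nzroots)%fset,
               weyl_sub P = weyl &
               least_reflection_number #|` P|]].

End RootSystem.

(* Main.v *)
From HB Require Import structures.
From mathcomp Require Import finmap boolp classical_sets.
From mathcomp Require Import all_boot all_order all_algebra.
From mathcomp Require Import zify ring.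
Require Import Defs.

Set Implicit Arguments.
Unset Strict Implicit.
Unset Printing Implicit Defensive.

Import Order.TTheory GRing.Theory Num.Theory.

Local Open Scope ring_scope.

(** The three classes agree because each of them consists of the generating
sets of roots that satisfy no nontrivial integral relation.  The heart of the
matter is [dependent_redundant]: if the roots of a set P satisfy a nontrivial
integral relation, then some root of P is obtained from the others by their
reflections, so that P can be shrunk without changing the group W_P.

Granting this, a minimal generating set P is independent, while the roots of
any generating set P' span all roots over the integers; comparing ranks,
|P| <= |P'| ([independent_card]).  So all minimal generating sets have the same
size, which is the least number of reflections that generate W, and the first
two classes coincide.  The last two coincide because W_P = W is equivalent to
W_P P being the set of all nonzero roots.  One direction is conjugation of
reflections.  For the other, if W_P = W then the set B of the nonzero roots
outside W_P P is stable under W.  The parity of the number of lines of B whose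
orientation is reversed is a homomorphism on W; it is even on the reflections in
roots outside B and odd on the reflections in B, so that B is empty
([reflection_not_word]).

To prove [dependent_redundant], take a relation of minimal support, with
coprime coefficients c_i, among roots of P.  The squared lengths f_i take the
value 1 and at most one other value, which is 2 or 3, because the system is
irreducible.  Put d_i = c_i f_i.  Up to passing to the dual system, the d_i are
coprime as well, and then some d_i is 1 or -1 ([exists_unit]).  Such a root is
short and is an integral combination of the other roots of the relation; an
argument on the length of an expression as a sum of roots shows that it lies in
the closure of these roots under reflections ([short_in_rclosure]).

It remains to see why some |d_i| is 1.  Make all coefficients nonnegative by
changing signs of roots, and argue by descent on the sum of the d_i.
Reflecting some members of the family in the root p_i changes the relation, but
it only affects the coefficient of p_i, and by an amount that can be read off
from the inner products.  In a smallest counterexample no such move makes d_i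
smaller, and this is a strong restriction.  For two roots with a negative inner
product it forces the values of d to differ by exactly one; then a root with
maximal d must be short, with d = 3, so that d takes only the values 2 and 3 on
the support of the relation.  The roots with d = 3 turn out to be pairwise
orthogonal, and those with d = 2 come in acute pairs of partners which are
otherwise orthogonal to each other.  Projecting the latter orthogonally to the
former gives vectors with a single linear relation, whose coefficients are all
positive.  So the positive semidefinite form is positive on every combination
of the projections that leaves one of them out, and a few explicit combinations
contradict this ([no_tight_circuit]).  The classification of root systems is
not used. *)

(** * Bilinear forms on integer vectors *)

Section Bilinear.
Variables (I : finType) (G : I -> I -> int).
Implicit Types (x y z : I -> int) (m : int).

Definition addv x y i := x i + y i.
Definition scalev m x i : int := m * x i.
Definition unitv (i j : I) : int := (j == i)%:R.
Definition bil x y : int := \sum_i \sum_j x i * y j * G i j.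

Lemma bilDl x y z : bil (addv x y) z = bil x z + bil y z.
Proof.
rewrite /bil -big_split; apply: eq_bigr => i _ /=; rewrite -big_split.
by apply: eq_bigr => j _; rewrite !mulrDl.
Qed.

Lemma bilZl m x y : bil (scalev m x) y = m * bil x y.
Proof.
rewrite /bil mulr_sumr; apply: eq_bigr => i _; rewrite mulr_sumr.
by apply: eq_bigr => j _; rewrite !mulrA.
Qed.

Hypothesis Gsym : forall i j, G i j = G j i.

Lemma bilC x y : bil x y = bil y x.
Proof.
rewrite /bil exchange_big; apply: eq_bigr => i _; apply: eq_bigr => j _.
by rewrite Gsym [x j * _]mulrC.
Qed.

Lemma bilDr x y z : bil z (addv x y) = bil z x + bil z y.
Proof. by rewrite !(bilC z) bilDl. Qed.

Lemma bilZr m x y : bil y (scalev m x) = m * bil y x.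
Proof. by rewrite !(bilC y) bilZl. Qed.

Lemma bil_unitr x j : bil x (unitv j) = \sum_i x i * G i j.
Proof.
apply: eq_bigr => i _; rewrite (bigD1 j) //= /unitv eqxx big1 ?addr0 ?mulr1 //.
by move=> k /negPf->; rewrite mulr0 mul0r.
Qed.

Lemma bil_unitv i j : bil (unitv i) (unitv j) = G i j.
Proof.
rewrite bil_unitr (bigD1 i) //= /unitv eqxx big1 ?addr0 ?mul1r //.
by move=> k /negPf->; rewrite mul0r.
Qed.

Lemma bil_sumr x y : bil x y = \sum_j y j * bil x (unitv j).
Proof.
rewrite /bil exchange_big; apply: eq_bigr => j _; rewrite -/(bil x _) bil_unitr mulr_sumr.
by apply: eq_bigr => i _; rewrite mulrA [x i * _]mulrC.
Qed.

End Bilinear.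

(** * Circuits that no reflection shortens *)

(** The plane of a long root i and a short root j with inner product -3 is a
root system of type G2.  A third root l with inner products 3 a and b with i and
j has twice its component orthogonal to this plane equal to
2 l + A i + B j, of squared norm Q.  In every case other than a = b = 0 the
component vanishes or Q < 0, and a relation with coefficients
(ci, 3 ci - 1, cl) is not proportional to (A, B, 2) unless cl fl = 1. *)
Lemma triple_arith (fl a b ci cl A B Q : int) : 0 < ci -> 0 < cl -> cl * fl <> 1 ->
  A = -4 * a - 2 * b -> B = -6 * a - 4 * b ->
  Q = 8 * fl + 6 * A * A + 2 * B * B + 12 * A * a + 4 * B * b - 6 * A * B ->
  (fl = 1 /\ (b = 0 \/ b = 1 \/ b = -1)) \/ (fl = 3 /\ (b = 0 \/ b = 3 \/ b = -3)) ->
  (a = 0 \/ a = 1 \/ a = -1) ->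
  (Q <= 0 -> 2 * ci = A * cl) -> (Q <= 0 -> 2 * (3 * ci - 1) = B * cl) ->
  a = 0 /\ b = 0.
Proof.
move=> ci0 cl0 nu AE BE -> [] [flE bE] aE; rewrite flE in nu *.
  by case: bE AE BE => [->|[]->]; case: aE => [->|[]->] => AE BE; rewrite AE BE; lia.
by case: bE AE BE => [->|[]->]; case: aE => [->|[]->] => AE BE; rewrite AE BE; lia.
Qed.

(** The setting is a smallest counterexample to the existence of a unit
coefficient: a family of roots with Gram matrix G, squared lengths 2 f i, and
nonnegative coefficients c of its relation.  [null] combines semidefiniteness
with the uniqueness of the relation on its support, [nounit] says that no
d i = c i * f i is 1, and [min] that reflecting the roots of a list s in the
root i does not decrease d i except to make it 1 in absolute value.  All the
lemmas of this section lead to the contradiction [no_tight_circuit]. *)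
Section Tight.
Variables (I : finType) (k : int) (f c : I -> int) (G : I -> I -> int).

(** Reflecting the root j in the root i subtracts weight i j from d i; it is
positive when the angle of i and j is obtuse. *)
Definition weight i j := - (c j * G j i).
Definition maxlen i j : int := if (f i == 1) && (f j == 1) then 1 else k.

Hypothesis kE : k = 2 \/ k = 3.
Hypothesis fE : forall i, f i = 1 \/ f i = k.
Hypothesis c_ge0 : forall i, 0 <= c i.
Hypothesis c_pos : exists i, 0 < c i.
Hypothesis Gsym : forall i j, G i j = G j i.
Hypothesis Gii : forall i, G i i = 2 * f i.
Hypothesis Goff : forall i j, i != j -> 0 < c i -> 0 < c j ->
  [\/ G i j = 0, G i j = maxlen i j | G i j = - maxlen i j].
Hypothesis row : forall i, \sum_j c j * G j i = 0.
Hypothesis null : forall x : I -> int, (forall i, c i = 0 -> x i = 0) ->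
  bil G x x <= 0 -> forall i j, x i * c j = x j * c i.
Hypothesis min : forall i (s : seq I), uniq (i :: s) -> 0 < c i ->
  let sg := \sum_(j <- s) weight i j in
  `|c i * f i - sg| = 1 \/ c i * f i <= `|c i * f i - sg|.
Hypothesis nounit : forall i, c i * f i <> 1.

Let d i : int := c i * f i.

Lemma len_gt0 i : 0 < f i.
Proof. by case: (fE i) => -> //; case: kE => ->. Qed.

Lemma sum_weight i : \sum_(j | j != i) weight i j = 2 * d i.
Proof.
have := row i; rewrite (bigD1 i) //= Gii => /eqP; rewrite addr_eq0 => /eqP e.
by rewrite sumrN /d mulrCA e.
Qed.

Lemma weight_gt0 i j : 0 < weight i j -> 0 < c j /\ G i j < 0.
Proof.
rewrite /weight Gsym; have := c_ge0 j; case: (ltgtP 0 (c j)) => // [h _|<-]; last by lia.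
by split=> //; nia.
Qed.

Lemma d_gt0 i : 0 < c i -> 0 < d i.
Proof. by move=> h; rewrite mulr_gt0 // len_gt0. Qed.

Lemma d_ge2 i : 0 < c i -> 2 <= d i.
Proof. by move=> h; have := d_gt0 h; have := @nounit i; rewrite /d; lia. Qed.

Lemma ex_obtuse i : 0 < c i -> exists2 j, j != i & 0 < weight i j.
Proof.
move=> ci; apply/exists_inP; apply: contraT; rewrite negb_exists_in => /forall_inP h.
have : \sum_(j | j != i) weight i j <= 0 by rewrite sumr_le0 // => j /h; rewrite -leNgt.
by rewrite sum_weight; have := d_gt0 ci; lia.
Qed.

(** By [min], the weight of j at i is d i - 1, d i + 1 or at least 2 d i, and
likewise with i and j exchanged.  At a long root both d and the weights are
multiples of k, so that only the last case is possible there.  Together, the two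
conditions leave a difference of one, and exclude two long roots. *)
Lemma obtuse_diff i j : i != j -> 0 < c i -> 0 < c j -> G i j < 0 ->
  (d i = d j + 1 \/ d j = d i + 1) /\ (f i = 1 \/ f j = 1) /\
  (k = 2 -> f i = 2 -> d i < d j).
Proof.
move=> ij ci cj Gn.
have := @min i [:: j]; have := @min j [:: i]; rewrite /= !inE eq_sym ij /= !big_seq1.
move=> /(_ isT cj) m1 /(_ isT ci) m2; move: m1 m2 (@nounit i) (@nounit j); rewrite /weight /d.
move: Gn; rewrite [G j i]Gsym.
have := Goff ij ci cj; rewrite /maxlen.
case: kE => kk; case: (fE i) => fi; case: (fE j) => fj; rewrite fi fj ?kk /=;
  case=> -> //; move=> _; lia.
Qed.

Lemma null_support (x : I -> int) i j : (forall i, c i = 0 -> x i = 0) ->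
  bil G x x <= 0 -> x i * c j = x j * c i.
Proof. by move=> x0 xx; apply: null. Qed.

(** If k = 2 an obtuse neighbour of a long root has a larger d.  If k = 3 the
root i and an obtuse neighbour j span a plane of type G2.  Every other root of
the relation is orthogonal to this plane by [triple_arith], so the relation
paired with i and j becomes a relation between these two independent roots. *)
Lemma long_not_max i : 0 < c i -> f i = k -> (forall j, d j <= d i) -> False.
Proof.
move=> ci fi dmax; have [j ji wj] := ex_obtuse ci.
have [cj Gij] := weight_gt0 wj; have ij : i != j by rewrite eq_sym.
have [dij [fij dlt]] := obtuse_diff ij ci cj Gij.
have := dmax j; case: kE => kk; first (by move: (dlt kk); rewrite fi kk; lia).
have {}fj : f j = 1 by move: fij; rewrite fi kk; lia.
have {}Gij : G i j = -3.
  by move: Gij; have := Goff ij ci cj; rewrite /maxlen fi fj kk /= => -[] ->; lia.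
move=> dj; have {}dij : c j = 3 * c i - 1.
  by move: dij dj; rewrite /d fi fj kk; lia.
have nbr l : l != i -> l != j -> 0 < c l -> G l i = 0 /\ G l j = 0.
  move=> li lj cl.
  have [a Ga aE] : exists2 a, G l i = 3 * a & a = 0 \/ a = 1 \/ a = -1.
    have := Goff li cl ci; rewrite /maxlen fi kk andbF.
    by case=> ->; [exists 0|exists 1|exists (-1)]; rewrite //; lia.
  pose b := G l j.
  pose A := -4 * a - 2 * b; pose B := -6 * a - 4 * b.
  pose x := addv (scalev 2 (unitv l)) (addv (scalev A (unitv i)) (scalev B (unitv j))).
  have x0 m : c m = 0 -> x m = 0.
    rewrite /x /addv /scalev /unitv.
    by do 3 case: eqVneq => [->|_]; lia.
  have xl : x l = 2.
    by rewrite /x /addv /scalev /unitv eqxx (negPf li) (negPf lj); lia.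
  have xi : x i = A.
    by rewrite /x /addv /scalev /unitv eqxx (negPf ij) eq_sym (negPf li); lia.
  have xj : x j = B.
    by rewrite /x /addv /scalev /unitv eqxx (negPf ji) eq_sym (negPf lj); lia.
  have xx : bil G x x = 4 * G l l + 6 * A * A + 2 * B * B + 4 * A * G l i
                        + 4 * B * G l j - 6 * A * B.
    rewrite /x !(bilDl, bilDr, bilZl, bilZr) // !bil_unitv //.
    rewrite !Gii [G i l]Gsym [G j l]Gsym [G j i]Gsym Gij fi fj kk; lia.
  have pxi := @null_support x l i x0; have pxj := @null_support x l j x0.
  rewrite xx xl xi xj in pxi pxj.
  have [] := triple_arith ci cl (@nounit l) (erefl A) (erefl B) (erefl _) _ aE.
  - have := Goff lj cl cj; rewrite /b /maxlen fj kk.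
    by case: (fE l) => ->; rewrite ?kk /=; case=> ->; clear; lia.
  - move=> le; apply: pxi; move: le; rewrite Gii Ga /b; clear; lia.
  - move=> le; rewrite -dij; apply: pxj; move: le; rewrite Gii Ga /b; clear; lia.
  by rewrite Ga /b => -> ->.
have s0 : \sum_(l | (l != i) && (l != j)) c l * G l i = 0.
  rewrite big1 // => l /andP[li lj]; have := c_ge0 l; rewrite le_eqVlt.
  by case/predU1P=> [<-|/(nbr _ li lj)[-> _]]; rewrite ?mul0r ?mulr0.
have s1 : \sum_(l | (l != i) && (l != j)) c l * G l j = 0.
  rewrite big1 // => l /andP[li lj]; have := c_ge0 l; rewrite le_eqVlt.
  by case/predU1P=> [<-|/(nbr _ li lj)[_ ->]]; rewrite ?mul0r ?mulr0.
have := row i; rewrite (bigD1 i) //= (bigD1 j) //= s0.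
have := row j; rewrite (bigD1 i) //= (bigD1 j) //= s1.
rewrite !Gii [G j i]Gsym Gij fi fj kk.
by lia.
Qed.

Definition obtuse i : {set I} := [set j | (j != i) && (0 < weight i j)].

(** The weights of all the other roots add up to 2 d i, and only the obtuse
neighbours contribute positively. *)
Lemma card_obtuse i w : (forall j, j \in obtuse i -> weight i j = w) ->
  2 * d i <= #|obtuse i|%:Z * w.
Proof.
move=> h; rewrite -sum_weight (bigID (mem (obtuse i))) /= -[#|obtuse i|%:Z]natz mulr_natl -sumr_const.
rewrite -[leRHS]addr0 lerD //.
  rewrite (eq_bigl (mem (obtuse i))) => [|j]; last by rewrite !inE andbA andbb.
  by rewrite le_eqVlt (eq_bigr _ h) eqxx.
by rewrite sumr_le0 // => j /andP[ji]; rewrite inE ji /= leNgt.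
Qed.

Lemma weight_short i j : f i = 1 -> 0 < c i -> j \in obtuse i -> weight i j = d j.
Proof.
move=> fi ci; rewrite inE => /andP[ji wj]; have [cj] := weight_gt0 wj.
rewrite /weight /d /maxlen; have := Goff ji cj ci; rewrite Gsym /maxlen fi andbT.
by case: (fE j) => fj; rewrite fj; case: kE => -> /=; case=> -> //; lia.
Qed.

Lemma obtuseP i j : 0 < c i -> j \in obtuse i ->
  [/\ j != i, 0 < c j, G i j < 0 & d i = d j + 1 \/ d j = d i + 1].
Proof.
move=> ci; rewrite inE => /andP[ji wj]; have [cj Gij] := weight_gt0 wj.
by have [|] := @obtuse_diff i j _ ci cj Gij; rewrite // eq_sym.
Qed.

(** At a root i where d is maximal all obtuse neighbours have weight d i - 1, and
at least three are needed to reach 2 d i.  Reflecting two of them turns d i into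
2 - d i, which is shorter; so d i - 2 = 1. *)
Lemma max_level : (forall i, d i <= 3) /\ exists2 i, 0 < c i & d i = 3.
Proof.
have [i0 ci0] := c_pos.
have [i _ dmax] := @Order.TotalTheory.arg_maxP _ _ _ i0 xpredT d isT.
have {}dmax j : d j <= d i by exact: dmax.
have ci : 0 < c i.
  have := dmax i0; have := d_gt0 ci0; have := c_ge0 i; rewrite le_eqVlt /d.
  by case/predU1P=> [<-|//]; rewrite mul0r; lia.
have fi : f i = 1 by case: (fE i) => // /(long_not_max ci)/(_ dmax).
have wE j : j \in obtuse i -> weight i j = d i - 1.
  move=> jo; rewrite (weight_short fi ci jo); have [_ _ _] := obtuseP ci jo.
  by have := dmax j; lia.
have : (1 < #|obtuse i|)%N.
  by have := card_obtuse wE; have := d_ge2 ci; nia.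
case/card_gt1P=> j1 [j2 [j1o j2o j12]].
have [n1 _ _ _] := obtuseP ci j1o; have [n2 _ _ _] := obtuseP ci j2o.
have := @min i [:: j1; j2]; rewrite /= !inE negb_or ![i == _]eq_sym n1 n2 j12.
move=> /(_ isT ci); rewrite !big_cons big_nil !wE // -/(d i).
have d3 := d_ge2 ci; move=> m.
have {m}d3 : d i = 3 by lia.
by split=> [j|]; [rewrite -d3 | exists i].
Qed.

Lemma d_le3 i : d i <= 3. Proof. by case: max_level. Qed.

Lemma levels i : 0 < c i ->
  [/\ d i = 3, f i = 1 & c i = 3] \/
  d i = 2 /\ ((f i = 1 /\ c i = 2) \/ [/\ k = 2, f i = 2 & c i = 1]).
Proof.
move=> ci; have := d_ge2 ci; have := d_le3 i.
have nl : f i = k -> d i <> 3.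
  by move=> fi di; apply: (long_not_max ci fi) => j; rewrite di d_le3.
move=> d3 d2; case: (fE i) => fi; last first.
  have := nl fi; move: d3 d2; rewrite /d fi; case: kE => kk; rewrite kk => *.
    by right; split; [lia | right; split=> //; lia].
  lia.
rewrite /d fi in d2 d3 *; have [c3|c3] := eqVneq (c i) 3.
  by left; split=> //; lia.
by right; split; [lia | left; split=> //; lia].
Qed.

Definition lvl3 := [set i | c i * f i == 3].
Definition lvl2 := [set i | c i * f i == 2].

Lemma lvl3P i : i \in lvl3 -> [/\ 0 < c i, f i = 1, c i = 3 & d i = 3].
Proof.
rewrite inE => /eqP di.
have ci : 0 < c i.
  by have := c_ge0 i; rewrite le_eqVlt => /predU1P[ci|//]; move/eqP: di; rewrite -ci mul0r.
by case: (levels ci) => [[]|[]] //; rewrite /d di.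
Qed.

Lemma lvl2P i : i \in lvl2 -> [/\ 0 < c i, d i = 2 &
  (f i = 1 /\ c i = 2) \/ [/\ k = 2, f i = 2 & c i = 1]].
Proof.
rewrite inE => /eqP di.
have ci : 0 < c i.
  by have := c_ge0 i; rewrite le_eqVlt => /predU1P[ci|//]; move/eqP: di; rewrite -ci mul0r.
by case: (levels ci) => [[]|[]] //; rewrite /d di.
Qed.

Lemma lvl2_or_lvl3 i : 0 < c i -> i \notin lvl3 -> i \in lvl2.
Proof.
by move=> /levels[[di _ _]|[di _]]; rewrite !inE -/(d i) di.
Qed.

Lemma lvl3_neq_lvl2 r p : r \in lvl3 -> p \in lvl2 -> r != p.
Proof. by rewrite !inE => /eqP r3 /eqP p2; apply/eqP => e; rewrite e p2 in r3. Qed.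

(** The relation, paired with the root p and sorted by levels. *)
Lemma row_levels p : 3 * (\sum_(r in lvl3) G r p) + \sum_(q in lvl2) c q * G q p = 0.
Proof.
rewrite -[RHS](row p) [RHS](bigID (mem lvl3)) /= mulr_sumr; congr (_ + _).
  by apply: eq_bigr => r /lvl3P[_ _ -> _].
rewrite [RHS](bigID (mem lvl2)) /= [X in _ + X]big1 ?addr0.
  apply: eq_bigl => q; case q2: (q \in lvl2); rewrite ?andbF // andbT.
  by move: q2; rewrite !inE => /eqP->.
move=> q /andP[q3 q2]; have := c_ge0 q; rewrite le_eqVlt => /predU1P[<-|cq].
  by rewrite mul0r.
by rewrite (lvl2_or_lvl3 cq q3) in q2.
Qed.

Lemma obtuse_level i j : 0 < c i -> j \in obtuse i ->
  if i \in lvl3 then j \in lvl2 else j \in lvl3.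
Proof.
move=> ci jo; have [_ cj _ h] := obtuseP ci jo.
have := d_le3 i; have := d_ge2 ci; have := d_le3 j; have := d_ge2 cj.
rewrite !inE -/(d i) -/(d j) => *; case: eqVneq => di; apply/eqP; lia.
Qed.

(** Two roots of level 3 are not obtuse as their levels do not differ by one.
An acute one would have weight -3, which together with three obtuse neighbours
of weight 2 adds up to 3 = d r: reflecting these four roots would remove r
from the relation. *)
Lemma lvl3_orth r r' : r \in lvl3 -> r' \in lvl3 -> r != r' -> G r r' = 0.
Proof.
move=> r3 r3' rr'; have [cr fr _ dr] := lvl3P r3; have [cr' fr' c3' dr'] := lvl3P r3'.
case: (Goff rr' cr cr') => //; rewrite /maxlen fr fr' /= => Grr; last first.
  have [] := obtuse_diff rr' cr cr' _; rewrite ?Grr //; lia.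
have wE j : j \in obtuse r -> weight r j = 2.
  move=> jo; rewrite (weight_short fr cr jo).
  by have := obtuse_level cr jo; rewrite r3 => /lvl2P[].
have : (2 < #|obtuse r|)%N by have := card_obtuse wE; rewrite dr; lia.
case/card_gt2P=> j1 [j2 [j3 [[o1 o2 o3] [n12 n23 n31]]]].
have neq j : j \in obtuse r -> (r != j) && (j != r').
  move=> jo; have := obtuse_level cr jo; rewrite r3 => j2'.
  by rewrite (lvl3_neq_lvl2 r3 j2') eq_sym (lvl3_neq_lvl2 r3' j2').
have := @min r [:: j1; j2; j3; r'].
have /andP[a1 b1] := neq _ o1; have /andP[a2 b2] := neq _ o2; have /andP[a3 b3] := neq _ o3.
rewrite /= !inE !negb_or a1 a2 a3 b1 b2 b3 rr' n12 n23 [j1 == j3]eq_sym n31 => /(_ isT cr).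
rewrite !big_cons big_nil (wE _ o1) (wE _ o2) (wE _ o3) /weight.
by rewrite [G r' r]Gsym Grr c3' -/(d r) dr; case.
Qed.

Lemma lvl2_nonobtuse p q : p \in lvl2 -> q \in lvl2 -> p != q -> 0 <= G p q.
Proof.
move=> /lvl2P[cp dp _] /lvl2P[cq dq _] pq; rewrite leNgt; apply/negP => Gpq.
by have [h _] := obtuse_diff pq cp cq Gpq; move: h; rewrite dp dq; lia.
Qed.

Lemma obtuse_lvl2 p o : p \in lvl2 -> o \in obtuse p -> o \in lvl3 /\ weight p o = 3 * f p.
Proof.
move=> p2 oo; have [cp dp fp] := lvl2P p2; have := obtuse_level cp oo.
have /negPf-> : p \notin lvl3 by apply/negP => /lvl3_neq_lvl2/(_ p2); rewrite eqxx.
move=> o3; split=> //; have [co fo co3 _] := lvl3P o3.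
have [op _ Gpo _] := obtuseP cp oo; move: Gpo.
have := Goff op co cp; rewrite /weight [G o p]Gsym /maxlen fo co3 /=.
by case: fp => -[]; [move=> -> _|move=> -> -> _]; case=> ->.
Qed.

Lemma card_obtuse_lvl2 p : p \in lvl2 -> 4 <= #|obtuse p|%:Z * (3 * f p).
Proof.
move=> p2; have [_ dp _] := lvl2P p2.
by have := @card_obtuse p (3 * f p) (fun j oj => (obtuse_lvl2 p2 oj).2); rewrite dp.
Qed.

(** A long root p has an obtuse neighbour o of weight 6, and an acute short root
of level 2 has weight -4.  Reflecting both would remove p from the relation. *)
Lemma long_short_orth p q : p \in lvl2 -> q \in lvl2 -> f p != 1 -> f q = 1 ->
  G p q = 0.
Proof.
move=> p2 q2 fp1 fq; have [cp dp fp] := lvl2P p2; have [cq dq _] := lvl2P q2.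
have pq : p != q by apply: contraNneq fp1 => ->; rewrite fq.
case: fp fp1 => -[]; first by move=> ->.
move=> kk fp cp1 _; have := Goff pq cp cq; rewrite /maxlen fp fq kk /=.
have Ge := lvl2_nonobtuse p2 q2 pq; case=> Gpq //; last by rewrite Gpq in Ge.
have [o oo] : exists o, o \in obtuse p.
  by apply/card_gt0P; have := card_obtuse_lvl2 p2; rewrite fp; lia.
have [o3 wo] := obtuse_lvl2 p2 oo.
have := @min p [:: o; q]; rewrite /= !inE negb_or pq eq_sym (lvl3_neq_lvl2 o3 p2).
rewrite (lvl3_neq_lvl2 o3 q2) => /(_ isT cp).
rewrite !big_cons big_nil wo fp /weight [G q p]Gsym Gpq cp1.
have -> : c q = 2 by move: dq; rewrite /d fq mulr1.
by case.
Qed.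

Lemma acute_len p q : p \in lvl2 -> q \in lvl2 -> p != q -> G p q != 0 ->
  f q = f p /\ G p q = f p.
Proof.
move=> p2 q2 pq Gn0; have [cp _ fp] := lvl2P p2; have [cq _ fq] := lvl2P q2.
have Ge := lvl2_nonobtuse p2 q2 pq.
have [ls sl] := (@long_short_orth p q p2 q2, @long_short_orth q p q2 p2).
have := Goff pq cp cq; move: Gn0 Ge ls sl; rewrite /maxlen [G q p]Gsym.
case: fp => -[]; [move=> fp _|move=> kk fp _]; case: fq => -[];
  [move=> fq _|move=> _ fq _|move=> fq _|move=> _ fq _]; rewrite fp fq.
- by move=> h1 h2 _ _ [] e; rewrite e in h1 h2 *.
- by move=> Gn _ _ sl; rewrite sl // in Gn.
- by move=> Gn _ ls; rewrite ls // in Gn.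
by rewrite kk => h1 h2 _ _ [] e; rewrite e in h1 h2 *.
Qed.

(** Each acute neighbour of level 2 has weight -2.  Two of them, together with
obtuse neighbours of total weight 6, would remove p from the relation. *)
Lemma acute_uniq p q q' : p \in lvl2 -> q \in lvl2 -> q' \in lvl2 -> p != q ->
  p != q' -> q != q' -> G p q != 0 -> G p q' = 0.
Proof.
move=> p2 q2 q2' pq pq' qq' Gq; apply/eqP/negPn/negP => Gq'.
have [fq {}Gq] := acute_len p2 q2 pq Gq; have [fq' {}Gq'] := acute_len p2 q2' pq' Gq'.
have [cp dp fp] := lvl2P p2; have [_ dq _] := lvl2P q2; have [_ dq' _] := lvl2P q2'.
have wq : weight p q = - 2 by rewrite /weight [G q p]Gsym Gq -fq -/(d q) dq.
have wq' : weight p q' = - 2 by rewrite /weight [G q' p]Gsym Gq' -fq' -/(d q') dq'.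
have on o : o \in obtuse p -> [/\ o != p, o != q & o != q'].
  by move=> /(obtuse_lvl2 p2)[o3 _]; rewrite !(lvl3_neq_lvl2 o3).
case: fp => -[fp].
  have : (1 < #|obtuse p|)%N by have := card_obtuse_lvl2 p2; rewrite fp; lia.
  case/card_gt1P=> o1 [o2 [oo1 oo2 o12]].
  have [p1 q1 q1'] := on _ oo1; have [p2' q2'' q2'''] := on _ oo2.
  have := @min p [:: o1; o2; q; q'].
  rewrite /= !inE !negb_or ![p == o1]eq_sym ![p == o2]eq_sym p1 p2' pq pq' o12 q1 q1' q2'' q2''' qq'.
  move=> /(_ isT cp); rewrite !big_cons big_nil.
  by rewrite (obtuse_lvl2 p2 oo1).2 (obtuse_lvl2 p2 oo2).2 wq wq' -/(d p) dp fp; case.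
move=> fp2 _; have : (0 < #|obtuse p|)%N by have := card_obtuse_lvl2 p2; rewrite fp2; lia.
case/card_gt0P=> o oo; have [op oq oq'] := on _ oo.
have := @min p [:: o; q; q'].
rewrite /= !inE !negb_or [p == o]eq_sym op pq pq' oq oq' qq'.
move=> /(_ isT cp); rewrite !big_cons big_nil.
by rewrite (obtuse_lvl2 p2 oo).2 wq wq' -/(d p) dp fp2; case.
Qed.

(** Modulo 3 the relation paired with p forces an acute neighbour of level 2. *)
Lemma partner_exists p : p \in lvl2 -> exists q, [/\ q \in lvl2, q != p, f q = f p, G p q = f p
   & (forall q', q' \in lvl2 -> q' != p -> q' != q -> G p q' = 0) /\
  \sum_(r in lvl3) G r p = -2].
Proof.
move=> p2; have [cp dp fp] := lvl2P p2.
have := row_levels p; rewrite [X in _ + X](bigD1 p) //= Gii [c p * _]mulrCA -/(d p) dp.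
case: (pickP [pred q in lvl2 | (p != q) && (G p q != 0)]) => [q|no] /=; last first.
  rewrite [X in _ + (_ + X)]big1 => [|q /=/andP[q2 qp]]; first by lia.
  have := no q; rewrite /= q2 eq_sym qp /= => /negbT/negPn/eqP Gpq.
  by rewrite Gsym Gpq mulr0.
case/and3P=> q2 pq Gn; have [fq Gpq] := acute_len p2 q2 pq Gn.
have qp : q != p by rewrite eq_sym.
have un q' : q' \in lvl2 -> q' != p -> q' != q -> G p q' = 0.
  by move=> q2' q'p q'q; apply: (@acute_uniq p q q'); rewrite // eq_sym.
have [_ dq _] := lvl2P q2.
rewrite [X in _ + (_ + X)](bigD1 q) ?q2 //= [G q p]Gsym Gpq -fq -/(d q) dq.
rewrite [X in _ + (_ + (_ + X))]big1 => [|q' /andP[/andP[q2' q'p] q'q]]; last first.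
  by rewrite Gsym un // mulr0.
move=> e; exists q; split=> //; first by rewrite fq.
by split=> //; lia.
Qed.

Definition partner p := odflt p [pick q in lvl2 | (q != p) && (G p q != 0)].

Lemma len_neq0 p : f p != 0. Proof. by have := len_gt0 p; case: ltgtP. Qed.

Lemma partnerP p : p \in lvl2 ->
  [/\ partner p \in lvl2, partner p != p, f (partner p) = f p & G p (partner p) = f p].
Proof.
move=> p2; have [q [q2 qp fq Gq [un _]]] := partner_exists p2.
rewrite /partner; case: pickP => [q' /and3P[q2' qp' Gq']|/(_ q)]; last first.
  by rewrite q2 qp Gq len_neq0.
have -> /= : q' = q by apply: contraNeq Gq' => /(un _ q2' qp')->.
by [].
Qed.

Lemma partner_lvl2 p : p \in lvl2 -> partner p \in lvl2. Proof. by case/partnerP. Qed.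
Lemma partner_neq p : p \in lvl2 -> partner p != p. Proof. by case/partnerP. Qed.

Lemma gram_nonpartner p q : p \in lvl2 -> q \in lvl2 -> q != p -> q != partner p -> G p q = 0.
Proof.
move=> p2 q2 qp qt; have [t [t2 tp ft Gt [un _]]] := partner_exists p2.
rewrite un //; have [s2 sp _ Gs] := partnerP p2.
apply: contraNneq qt => ->; apply/eqP/esym; apply: contraTeq isT => tt.
by have := un _ s2 sp tt; rewrite Gs => /eqP; rewrite (negPf (len_neq0 p)).
Qed.

Lemma partnerK p : p \in lvl2 -> partner (partner p) = p.
Proof.
move=> p2; have [t2 tp ft Gt] := partnerP p2; apply: contraTeq isT => tt.
have : G (partner p) p = 0 by apply: gram_nonpartner; rewrite // eq_sym.
by rewrite Gsym Gt => /eqP; rewrite (negPf (len_neq0 p)).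
Qed.

Lemma partner_eq p q : p \in lvl2 -> q \in lvl2 -> (partner p == q) = (p == partner q).
Proof. by move=> p2 q2; apply/eqP/eqP => [<-|->]; rewrite partnerK. Qed.

Lemma sum_lvl3 p : p \in lvl2 -> \sum_(r in lvl3) G r p = -2.
Proof. by case/partner_exists=> q [_ _ _ _ []]. Qed.

Lemma gram_lvl3 r r' : r \in lvl3 -> r' \in lvl3 -> G r r' = 2 * (r == r')%:R.
Proof.
move=> r3 r3'; case: eqVneq => [<-|/(lvl3_orth r3 r3')->//].
by rewrite Gii; have [_ -> _ _] := lvl3P r3.
Qed.

(** [hatv p] is twice the projection of the root p to the orthogonal complement of
the roots of level 3, and [hatp] is half the Gram matrix of these vectors. *)
Definition hatp p q := 2 * G p q - \sum_(r in lvl3) G r p * G r q.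
Definition hatv p := addv (scalev 2 (unitv p)) (fun r => if r \in lvl3 then - G r p else 0).

Lemma hatpC p q : hatp p q = hatp q p.
Proof. by rewrite /hatp Gsym; congr (_ - _); apply: eq_bigr => r _; rewrite mulrC. Qed.

Lemma bil_hatv_unitv p q : bil G (hatv p) (unitv q) = hatp p q.
Proof.
rewrite bilDl bilZl bil_unitv /hatp; congr (_ + _).
rewrite bil_unitr -sumrN [RHS]big_mkcond; apply: eq_bigr => r _.
by case: ifP; rewrite ?mulNr ?mul0r.
Qed.

Lemma hatp_lvl3 p r : r \in lvl3 -> hatp p r = 0.
Proof.
move=> r3; rewrite /hatp (bigD1 r) //= big1 => [|r' /andP[r3' /negPf rr']].
  by rewrite (gram_lvl3 r3 r3) eqxx [G p r]Gsym; lia.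
by rewrite (gram_lvl3 r3' r3) rr' !mulr0.
Qed.

Lemma bil_hatv p q : bil G (hatv p) (hatv q) = 2 * hatp p q.
Proof.
rewrite {2}/hatv bilDr // bilZr // bil_hatv_unitv bil_sumr // big1 ?addr0 // => r _.
by rewrite bil_hatv_unitv; case: ifP => [/(hatp_lvl3 p)->|]; rewrite ?mul0r ?mulr0.
Qed.

Lemma hatvE p q : p \in lvl2 -> q \in lvl2 -> hatv p q = 2 * (q == p)%:R.
Proof.
move=> p2 q2; rewrite /hatv /addv /scalev /unitv.
have /negPf-> : q \notin lvl3 by apply/negP => /lvl3_neq_lvl2/(_ q2); rewrite eqxx.
by rewrite addr0.
Qed.

Lemma hatv_supp p i : p \in lvl2 -> c i = 0 -> hatv p i = 0.
Proof.
move=> p2 ci; rewrite /hatv /addv /scalev /unitv.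
have /negPf-> : i \notin lvl3 by apply/negP => /lvl3P[]; rewrite ci.
by have /negPf-> : i != p by apply: contraTneq p2 => <-; apply/negP => /lvl2P[]; rewrite ci.
Qed.

(** A null vector is proportional to c, hence has full support. *)
Lemma bil_pos x i j : (forall l, c l = 0 -> x l = 0) -> 0 < c j -> x j = 0 -> x i <> 0 ->
  0 < bil G x x.
Proof.
move=> x0 cj xj xi; rewrite ltNge; apply/negP => /(null_support i j x0).
by rewrite xj mul0r => /eqP; rewrite mulf_eq0 (gt_eqF cj) orbF => /eqP.
Qed.

Lemma len_lvl2 p : p \in lvl2 -> f p = 1 \/ f p = 2.
Proof. by case/lvl2P=> _ _ [[]|[]]; [left|right]. Qed.

Lemma gram_lvl32 r p : r \in lvl3 -> p \in lvl2 -> [\/ G r p = 0, G r p = f p | G r p = - f p].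
Proof.
move=> r3 p2; have [cp _ fp] := lvl2P p2; have [cr fr _ _] := lvl3P r3.
have := Goff (lvl3_neq_lvl2 r3 p2) cr cp; rewrite /maxlen fr /=.
by case: fp => -[]; [move=> -> _|move=> -> -> _].
Qed.

(** If p had an acute neighbour of level 3, then the sum of its inner products
with level 3 being -2, its obtuse neighbours there would be so many that its
projection would have norm at most 0. *)
Lemma gram_lvl32_le0 r p : r \in lvl3 -> p \in lvl2 -> G r p = 0 \/ G r p = - f p.
Proof.
move=> r3 p2; case: (gram_lvl32 r3 p2) => [->|Grp|->]; [by left| |by right].
have t2 := partner_lvl2 p2; have [ct _ _] := lvl2P t2.
have : 0 < bil G (hatv p) (hatv p).
  apply: (@bil_pos _ p (partner p)) => // [l||]; first exact: hatv_supp.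
    by rewrite hatvE // (negPf (partner_neq p2)).
  by rewrite hatvE // eqxx.
rewrite bil_hatv /hatp Gii.
have e : \sum_(r in lvl3) G r p * G r p = \sum_(r in lvl3) (G r p * G r p + f p * G r p) + 2 * f p.
  by rewrite big_split /= -mulr_sumr sum_lvl3 //; ring.
have : 2 * f p * f p <= \sum_(r in lvl3) (G r p * G r p + f p * G r p).
  rewrite (bigD1 r) //= Grp -[leLHS]addr0 lerD //; first by lia.
  apply: sumr_ge0 => r' /andP[r3' _].
  case: (gram_lvl32 r3' p2) => ->; have := len_gt0 p; nia.
rewrite e; have := len_lvl2 p2; clear; case=> ->; lia.
Qed.

Lemma row_lvl3 r : r \in lvl3 -> \sum_(p in lvl2) c p * G p r = -6.
Proof.
move=> r3; have := row_levels r; rewrite (bigD1 r) //= big1 => [|r' /andP[r3' rr']]; last exact: lvl3_orth.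
by rewrite Gii; have [_ -> _ _] := lvl3P r3; lia.
Qed.

Definition nbrs3 p := [set r in lvl3 | G r p != 0].
Definition nbrs2 r := [set p in lvl2 | G r p != 0].

Lemma mem_nbrs3 p r : (r \in nbrs3 p) = (r \in lvl3) && (G r p != 0).
Proof. by rewrite [LHS]inE. Qed.

Lemma mem_nbrs2 p r : (p \in nbrs2 r) = (p \in lvl2) && (G r p != 0).
Proof. by rewrite [LHS]inE. Qed.

Lemma gram_nbrs3 r p : r \in lvl3 -> p \in lvl2 -> G r p = - (f p * (r \in nbrs3 p)%:R).
Proof.
by move=> r3 p2; rewrite mem_nbrs3 r3; case: (gram_lvl32_le0 r3 p2) => ->; rewrite ?oppr_eq0 ?eqxx ?len_neq0; lia.
Qed.

Lemma nbrs3_nbrs2 p r : p \in lvl2 -> r \in lvl3 -> (r \in nbrs3 p) = (p \in nbrs2 r).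
Proof. by move=> p2 r3; rewrite mem_nbrs3 mem_nbrs2 p2 r3. Qed.

Lemma sum1_int (T : finType) (A : {set T}) : \sum_(x in A) (1 : int) = #|A|%:Z.
Proof. by rewrite sumr_const -[RHS]natz. Qed.

Lemma card_nbrs3 p : p \in lvl2 -> #|nbrs3 p|%:Z * f p = 2.
Proof.
move=> p2; apply: oppr_inj; rewrite -(sum_lvl3 p2) -sum1_int mulr_suml -sumrN.
rewrite [LHS]big_mkcond [RHS]big_mkcond; apply: eq_bigr => r _.
case r3: (r \in lvl3); last by rewrite mem_nbrs3 r3.
by rewrite gram_nbrs3 //; case: (r \in nbrs3 p); lia.
Qed.

Lemma card_nbrs2 r : r \in lvl3 -> #|nbrs2 r| = 3.
Proof.
move=> r3; have := row_lvl3 r3.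
suff -> : \sum_(p in lvl2) c p * G p r = - (2 * #|nbrs2 r|%:Z) by lia.
rewrite -sum1_int mulr_sumr -sumrN big_mkcond [RHS]big_mkcond.
apply: eq_bigr => p _; case p2: (p \in lvl2); last by rewrite mem_nbrs2 p2.
rewrite Gsym gram_nbrs3 // nbrs3_nbrs2 //; have [_ dp _] := lvl2P p2.
by rewrite mulrN mulrA -/(d p) dp; case: (p \in nbrs2 r); lia.
Qed.

Definition common p q := #|nbrs3 p :&: nbrs3 q|.

Lemma hatpE p q : p \in lvl2 -> q \in lvl2 -> hatp p q = 2 * G p q - f p * f q * (common p q)%:Z.
Proof.
move=> p2 q2; rewrite /hatp /common -sum1_int mulr_sumr; congr (_ - _).
rewrite big_mkcond [RHS]big_mkcond; apply: eq_bigr => r _.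
case r3: (r \in lvl3); last by rewrite in_setI mem_nbrs3 r3.
by rewrite !gram_nbrs3 // in_setI; case: (r \in nbrs3 p); case: (r \in nbrs3 q); rewrite /=; lia.
Qed.

Lemma hatp_diag p : p \in lvl2 -> hatp p p = 2 * f p.
Proof. by move=> p2; rewrite hatpE // /common setIid Gii -mulrA [f p * #|_|%:Z]mulrC card_nbrs3 //; lia. Qed.

Lemma hatp_partner p : p \in lvl2 -> hatp p (partner p) = 2 * f p - f p * f p * (common p (partner p))%:Z.
Proof. by move=> p2; have [t2 _ ft Gt] := partnerP p2; rewrite hatpE // Gt ft. Qed.

Lemma hatp_other p q : p \in lvl2 -> q \in lvl2 -> q != p -> q != partner p ->
  hatp p q = - (f p * f q * (common p q)%:Z).
Proof. by move=> p2 q2 qp qt; rewrite hatpE // gram_nonpartner // sub0r. Qed.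

Fixpoint hatsum (l : seq I) : I -> int :=
  if l is p :: l' then addv (hatv p) (hatsum l') else fun=> 0.

Lemma bil_hatsum l l' : bil G (hatsum l) (hatsum l') = 2 * \sum_(p <- l) \sum_(q <- l') hatp p q.
Proof.
have e x : bil G x (fun=> 0) = 0.
  by rewrite bil_sumr // big1 // => i _; rewrite mul0r.
elim: l => [|p l IH]; first by rewrite big_nil bilC // e.
rewrite big_cons /= bilDl IH mulrDr; congr (_ + _).
elim: l' {IH} => [|q l' IH]; first by rewrite big_nil /= e.
by rewrite /= bilDr // IH big_cons mulrDr bil_hatv.
Qed.

(** The list may contain repetitions, which serve as coefficients. *)
Lemma hat_pos p l j : all [in lvl2] (p :: l) -> j \in lvl2 -> j \notin p :: l ->
  0 < \sum_(a <- p :: l) \sum_(b <- p :: l) hatp a b.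
Proof.
move/allP=> l_lvl2 j2 jl; suff: 0 < bil G (hatsum (p :: l)) (hatsum (p :: l)) by rewrite bil_hatsum pmulr_rgt0.
have [cj _ _] := lvl2P j2.
have yE m : {subset m <= lvl2} -> forall q, q \in lvl2 -> hatsum m q = 2 * (count_mem q m)%:R.
  elim: m => [|a m IH] ma q q2 /=; first by rewrite mulr0.
  have a2 : a \in lvl2 by apply: ma; rewrite inE eqxx.
  rewrite /addv hatvE // IH // => [|x xm]; last by apply: ma; rewrite inE xm orbT.
  by rewrite natrD mulrDr [q == a]eq_sym.
apply: (@bil_pos _ p j) => //.
- move=> i ci; elim: (p :: l) l_lvl2 => //= a m IH ma; rewrite /addv hatv_supp ?IH //.
    by move=> x xm; apply: ma; rewrite inE xm orbT.
  by apply: ma; rewrite inE eqxx.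
- by rewrite yE // (count_memPn jl) mulr0.
- by rewrite yE ?l_lvl2 ?inE ?eqxx //= eqxx; lia.
Qed.

(** Without a common neighbour in level 3, partners would have the same
projection, and their difference would be a relation with coefficients of
opposite signs. *)
Lemma common_partner p : p \in lvl2 -> (0 < common p (partner p))%N.
Proof.
move=> p2; have [t2 tp ft Gt] := partnerP p2.
have [cp _ _] := lvl2P p2; have [ct _ _] := lvl2P t2.
pose x := addv (hatv p) (scalev (-1) (hatv (partner p))).
have : 0 < bil G x x.
  rewrite ltNge; apply/negP => le0; have := @null_support x p (partner p) _ le0.
  rewrite /x /addv /scalev !hatvE // eqxx [p == _]eq_sym (negPf tp) eqxx => e.
  suff: false by []. move: e.
  have -> /= : 2 * 1%:R + -1 * (2 * 0%:R) = 2 :> int by [].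
  have -> /= : 2 * 0%:R + -1 * (2 * 1%:R) = -2 :> int by [].
  have s i : c i = 0 -> hatv p i + -1 * hatv (partner p) i = 0.
    by move=> ci; rewrite !hatv_supp.
  by move=> /(_ s); move: cp ct; clear; lia.
have := (bil_hatv p p, bil_hatv p (partner p), bil_hatv (partner p) (partner p)); rewrite /x.
move: (hatv p) (hatv (partner p)) => u v [[uu uv] vv].
rewrite bilDl !bilDr // !bilZl !bilZr // [bil G v u]bilC // uu uv vv hatp_partner // !hatp_diag // ft.
by have := len_lvl2 p2; clear; case=> ->; lia.
Qed.

Lemma partner_inj p q : p \in lvl2 -> q \in lvl2 -> (partner p == partner q) = (p == q).
Proof. by move=> p2 q2; rewrite partner_eq ?partner_lvl2 // partnerK. Qed.

Lemma common_gt0 p q r : r \in nbrs3 p -> r \in nbrs3 q -> (0 < common p q)%N.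
Proof. by move=> rp rq; apply/card_gt0P; exists r; rewrite in_setI rp rq. Qed.

Lemma hatp_nonpartner_le p q : p \in lvl2 -> q \in lvl2 -> q != p -> q != partner p ->
  (0 < common p q)%N -> hatp p q <= - (f p * f q).
Proof.
move=> p2 q2 qp qt; rewrite hatp_other //; have := len_gt0 p; have := len_gt0 q; nia.
Qed.

Lemma hatp_nonpartner_le0 p q : p \in lvl2 -> q \in lvl2 -> q != p -> q != partner p ->
  hatp p q <= 0.
Proof.
move=> p2 q2 qp qt; rewrite hatp_other //; have := len_gt0 p; have := len_gt0 q; nia.
Qed.

Lemma nbrs2P r p : p \in nbrs2 r -> r \in lvl3 -> p \in lvl2 /\ r \in nbrs3 p.
Proof. by move=> pr r3; rewrite mem_nbrs3 r3; move: pr; rewrite mem_nbrs2 => /andP[]. Qed.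

Lemma nbrs2_third r p q : r \in lvl3 -> p \in nbrs2 r -> q \in nbrs2 r -> q != p ->
  exists w, [/\ w \in nbrs2 r, w != p, w != q & nbrs2 r = [set p; q; w]].
Proof.
move=> r3 pr qr qp; have := card_nbrs2 r3.
rewrite (cardsD1 p) pr (cardsD1 q) in_setD1 qp qr => -[] /eqP/cards1P[w e].
have : w \in [set w] by rewrite set11.
rewrite -e in_setD1 in_setD1 => /and3P[wq wp wr]; exists w; split=> //.
apply/setP => x; rewrite !in_setU !in_set1.
have : (x != q) && ((x != p) && (x \in nbrs2 r)) = (x == w).
  by rewrite -[RHS]in_set1 -e !in_setD1.
case: (eqVneq x p) => [->|xp]; first by rewrite pr.
by case: (eqVneq x q) => [->|xq]; first by rewrite qr.
Qed.

(** A long root p of level 2 has a single neighbour r of level 3, shared with its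
partner.  If q is the third neighbour of r, then p + q, or 2 q + p + partner p
when q is short, has a projection of norm at most 0. *)
Lemma all_short p : p \in lvl2 -> f p = 1.
Proof.
move=> p2; case: (len_lvl2 p2) => // fp; have [t2 tp ft Gt] := partnerP p2.
have /card_gt0P[r] := common_partner p2; rewrite in_setI => /andP[rp rt].
have r3 : r \in lvl3 by move: rp; rewrite mem_nbrs3 => /andP[].
have [q [qr qp qt _]] := nbrs2_third r3 (etrans (esym (nbrs3_nbrs2 p2 r3)) rp)
  (etrans (esym (nbrs3_nbrs2 t2 r3)) rt) tp.
have [q2 rq] := nbrs2P qr r3.
have hpq := hatp_nonpartner_le p2 q2 qp qt (common_gt0 rp rq).
have hpt : hatp p (partner p) <= 0 by rewrite hatp_partner // fp; move: (common_partner p2); clear; lia.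
have hpp := hatp_diag p2; have hqq := hatp_diag q2; have htt := hatp_diag t2.
have htq : hatp (partner p) q <= - (f (partner p) * f q).
  by apply: hatp_nonpartner_le => //; rewrite ?partnerK //; apply: common_gt0 rt rq.
case: (len_lvl2 q2) => fq.
  have := @hat_pos q [:: q; p; partner p] (partner q).
  rewrite /= p2 q2 t2 partner_lvl2 // !inE !negb_or partner_neq // partner_eq // qt partner_inj // qp.
  move=> /(_ isT isT isT); rewrite !big_cons !big_nil.
  rewrite [hatp q p]hatpC [hatp q (partner p)]hatpC [hatp (partner p) p]hatpC.
  by move: hpq hpt hpp hqq htt htq; rewrite ft fp fq; clear; lia.
have := @hat_pos p [:: q] (partner p).
rewrite /= p2 q2 t2 // !inE !negb_or partner_neq // [partner p == q]eq_sym qt.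
move=> /(_ isT isT isT); rewrite !big_cons !big_nil [hatp q p]hatpC.
by move: hpq hpp hqq; rewrite fp fq; clear; lia.
Qed.

(** Three neighbours of r no two of which are partners would have projections
of squared norm 1 and mutual inner products at most -1/2, with a null sum. *)
Lemma nbrs2_has_partners r : r \in lvl3 -> exists2 u, u \in nbrs2 r & partner u \in nbrs2 r.
Proof.
move=> r3; apply/exists_inP; apply: contraT; rewrite negb_exists_in => /forall_inP no.
have : (2 < #|nbrs2 r|)%N by rewrite card_nbrs2.
case/card_gt2P=> u [v [w [[ur vr wr] [uv vw wu]]]].
have [[[u2 ru] [v2 rv]] [w2 rw]] := (nbrs2P ur r3, nbrs2P vr r3, nbrs2P wr r3).
have ne a b : a \in nbrs2 r -> b \in nbrs2 r -> b != partner a.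
  by move=> ar br; apply: contraNneq (no a ar) => <-.
have hl a b : a \in nbrs2 r -> b \in nbrs2 r -> b != a -> hatp a b <= -1.
  move=> ar br ba; have [[a2 ra] [b2 rb]] := (nbrs2P ar r3, nbrs2P br r3).
  have := hatp_nonpartner_le a2 b2 ba (ne _ _ ar br) (common_gt0 ra rb).
  by rewrite !all_short.
have := @hat_pos u [:: v; w] (partner u).
rewrite /= u2 v2 w2 partner_lvl2 // !inE !negb_or partner_neq // ![partner u == _]eq_sym !ne //.
move=> /(_ isT isT isT); rewrite !big_cons !big_nil !hatp_diag // !all_short //.
rewrite [hatp v u]hatpC [hatp u w]hatpC [hatp w v]hatpC.
have := hl u v ur vr; have := hl v w vr wr; have := hl w u wr ur.
rewrite [v == u]eq_sym [w == v]eq_sym [u == w]eq_sym uv vw wu => /(_ isT) + /(_ isT) + /(_ isT).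
by clear; lia.
Qed.

(** A counting device: at a root r of level 3 the charges of its neighbours, two
partners and a third root, cancel, whereas a root p that shares exactly one
neighbour with its partner has total charge -1.  Hence some p shares both of
its neighbours with its partner. *)
Definition charge p r : int := if r \in nbrs3 p then (if r \in nbrs3 (partner p) then 1 else -2) else 0.

Lemma sum_charge_lvl2 r : r \in lvl3 -> \sum_(p in lvl2) charge p r = 0.
Proof.
move=> r3; have [u ur tr] := nbrs2_has_partners r3.
have [u2 ru] := nbrs2P ur r3; have [t2 rt] := nbrs2P tr r3.
have tu := partner_neq u2.
have [w [wr wu weight nE]] := nbrs2_third r3 ur tr tu; have [w2 rw] := nbrs2P wr r3.
have rtw : r \in nbrs3 (partner w) = false.
  rewrite nbrs3_nbrs2 ?partner_lvl2 // nE !in_setU !in_set1 partner_eq // (negPf weight) partner_inj //.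
  by rewrite (negPf wu) (negPf (partner_neq w2)).
rewrite (bigID (mem (nbrs2 r))) /= [X in _ + X]big1 ?addr0 => [|p /andP[p2 pr]]; last first.
  by rewrite /charge nbrs3_nbrs2 // (negPf pr).
rewrite (eq_bigl (mem (nbrs2 r))) => [|p]; last first.
  by rewrite /= mem_nbrs2; case: (p \in lvl2).
rewrite nE setUC big_setU1 /=; last by rewrite !inE negb_or wu.
rewrite big_setU1 /=; last by rewrite inE eq_sym.
by rewrite big_set1 /charge rw rtw ru rt partnerK // ru.
Qed.

Lemma sum_charge_lvl3 p : p \in lvl2 -> \sum_(r in lvl3) charge p r = 3 * (common p (partner p))%:Z - 4.
Proof.
move=> p2; have := card_nbrs3 p2; rewrite all_short // mulr1 => e.
have cardE (X : {set I}) : X \subset lvl3 -> #|X|%:Z = \sum_(r in lvl3) (r \in X)%:Z.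
  move/subsetP=> XA; rewrite -sum1_int big_mkcond [RHS]big_mkcond.
  by apply: eq_bigr => r _; case rX: (r \in X); [rewrite XA | case: ifP].
have nA : nbrs3 p \subset lvl3 by apply/subsetP => r; rewrite mem_nbrs3 => /andP[].
have -> : 4 = 2 * #|nbrs3 p|%:Z by rewrite e.
rewrite /common !cardE //; last exact: subset_trans (subsetIl _ _) nA.
rewrite !mulr_sumr -sumrB; apply: eq_bigr => r _.
by rewrite /charge in_setI; case: (r \in nbrs3 p); case: (r \in nbrs3 (partner p)).
Qed.

Lemma card_nbrs3_eq2 p : p \in lvl2 -> #|nbrs3 p| = 2%N.
Proof. by move=> p2; have := card_nbrs3 p2; rewrite all_short // mulr1 => -[]. Qed.

Lemma ex_twins : exists2 p, p \in lvl2 & nbrs3 p = nbrs3 (partner p).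
Proof.
have [r0 cr0 dr0] : exists2 r, 0 < c r & d r = 3 by case: max_level.
have [u ur tr] : exists2 u, u \in nbrs2 r0 & partner u \in nbrs2 r0.
  by apply: nbrs2_has_partners; rewrite inE; apply/eqP.
have u2 : u \in lvl2 by move: ur; rewrite mem_nbrs2 => /andP[].
have : \sum_(p in lvl2) (3 * (common p (partner p))%:Z - 4) = 0.
  rewrite -(eq_bigr _ sum_charge_lvl3) exchange_big /= big1 // => r; exact: sum_charge_lvl2.
have [/exists_inP[p p2 cp] _|] := boolP [exists p in lvl2, (1 < common p (partner p))%N].
  have t2 := partner_lvl2 p2; exists p => //.
  have e : nbrs3 p :&: nbrs3 (partner p) = nbrs3 p.
    by apply/eqP; rewrite eqEcard subsetIl card_nbrs3_eq2.
  by apply/eqP; rewrite eqEcard -{1}e subsetIr !card_nbrs3_eq2.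
rewrite negb_exists_in => /forall_inP no e; suff: false by [].
have : \sum_(p in lvl2) (3 * (common p (partner p))%:Z - 4) <= \sum_(p in lvl2) (-1).
  by apply: ler_sum => p /no; clear; lia.
by rewrite e sumrN sum1_int oppr_ge0 (cardsD1 u) u2.
Qed.

(** Let p and its partner have the same neighbours r1 and r2 of level 3, and let
q1 and q2 be the third neighbours of r1 and r2.  They are distinct, as otherwise
the projection of p + q1 would vanish.  Unless q1 and q2 are partners, the
projection of p + partner p + q1 + q2 has norm at most 0.  If they are, they
share a third neighbour r3; adding the remaining neighbour u of r3 to the sum
again gives norm at most 0.  In each case the partner of one of the summands is
left out, which [hat_pos] forbids. *)
Lemma no_tight_circuit : False.
Proof.
have [p p2 np] := ex_twins; have [t2 tp _ _] := partnerP p2.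
have : (1 < #|nbrs3 p|)%N by rewrite card_nbrs3_eq2.
case/card_gt1P=> r1 [r2 [r1p r2p r12]].
have nb_lvl3 r q : r \in nbrs3 q -> r \in lvl3 by rewrite mem_nbrs3 => /andP[].
have npE r : r \in nbrs3 p -> r = r1 \/ r = r2.
  move=> rp; have := card_nbrs3_eq2 p2; rewrite (cardsD1 r1) r1p (cardsD1 r2).
  rewrite in_setD1 eq_sym r12 r2p => -[] /eqP; rewrite cards_eq0 => /eqP e.
  case: (eqVneq r r1) => [|n1]; first by left.
  case: (eqVneq r r2) => [|n2]; first by right.
  by have := in_set0 r; rewrite -e !in_setD1 n1 n2 rp.
have tw r : r \in nbrs3 p -> exists w, [/\ w \in lvl2, r \in nbrs3 w, w != p, w != partner p
    & nbrs2 r = [set p; partner p; w]].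
  move=> rp; have r3 := nb_lvl3 _ _ rp.
  have [w [wr wp weight nE]] : exists w, [/\ w \in nbrs2 r, w != p, w != partner p & nbrs2 r = [set p; partner p; w]].
    by apply: nbrs2_third => //; rewrite -?nbrs3_nbrs2 // -np.
  by have [w2 rw] := nbrs2P wr r3; exists w.
have [q1 [q12 rq1 q1p q1t nE1]] := tw _ r1p.
have [q2 [q22 rq2 q2p q2t nE2]] := tw _ r2p.
have h1 := hatp_diag; have hs := all_short.
have hpt : hatp p (partner p) = 0.
  by rewrite hatp_partner // !hs // /common -np setIid card_nbrs3_eq2.
have hpq q r : r \in nbrs3 p -> r \in nbrs3 q -> q \in lvl2 -> q != p -> q != partner p ->
    hatp p q <= -1 /\ hatp (partner p) q <= -1.
  move=> rp rq qA qp qt; split.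
    have := hatp_nonpartner_le p2 qA qp qt (common_gt0 rp rq); by rewrite !hs.
  have := @hatp_nonpartner_le (partner p) q t2 qA qt; rewrite partnerK // !hs //; apply=> //.
  by apply: (@common_gt0 _ _ r); rewrite -?np.
have [hpq1 htq1] := hpq _ _ r1p rq1 q12 q1p q1t.
have [hpq2 htq2] := hpq _ _ r2p rq2 q22 q2p q2t.
have q12n : q1 != q2.
  apply/negP => /eqP e.
  have cc : common p q1 = 2%N.
    have -> : common p q1 = #|nbrs3 p|; last exact: card_nbrs3_eq2.
    rewrite /common; congr #|pred_of_set _|; apply/setIidPl/subsetP => r /npE[]->//.
    by rewrite e.
  have := @hat_pos p [:: q1] (partner p).
  rewrite /= p2 q12 t2 !inE !negb_or tp [partner p == q1]eq_sym q1t => /(_ isT isT isT).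
  rewrite !big_cons !big_nil [hatp q1 p]hatpC !h1 // !hs // hatp_other // cc !hs //.
have q2E : q2 = partner q1.
  apply/eqP; apply: contraT => ne.
  have hqq : hatp q1 q2 <= 0 by apply: hatp_nonpartner_le0 => //; rewrite eq_sym.
  have := @hat_pos p [:: partner p; q1; q2] (partner q1).
  rewrite /= p2 q12 t2 q22 partner_lvl2 // !inE !negb_or partner_neq // partner_eq // q1t partner_inj //.
  rewrite q1p [partner q1 == q2]eq_sym ne => /(_ isT isT isT); rewrite !big_cons !big_nil !h1 // !hs //.
  rewrite [hatp (partner p) p]hatpC [hatp q1 p]hatpC [hatp q2 p]hatpC [hatp q1 (partner p)]hatpC [hatp q2 (partner p)]hatpC [hatp q2 q1]hatpC.
  by move: hpt hpq1 hpq2 htq1 htq2 hqq; clear; lia.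
have /card_gt0P[r3] := common_partner q12; rewrite -q2E in_setI => /andP[r3q1 r3q2].
have r33 := nb_lvl3 _ _ r3q1.
have r31 : r3 != r1.
  apply/negP => /eqP e; have : q2 \in nbrs2 r1 by rewrite -e -nbrs3_nbrs2.
  by rewrite nE1 !in_setU !in_set1 (negPf q2p) (negPf q2t) eq_sym (negPf q12n).
have r32 : r3 != r2.
  apply/negP => /eqP e; have : q1 \in nbrs2 r2 by rewrite -e -nbrs3_nbrs2.
  by rewrite nE2 !in_setU !in_set1 (negPf q1p) (negPf q1t) (negPf q12n).
have r3p : r3 \notin nbrs3 p by apply/negP => /npE[]; apply/eqP.
have [u [ur uq1 uq2 _]] : exists u, [/\ u \in nbrs2 r3, u != q1, u != q2 & nbrs2 r3 = [set q1; q2; u]].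
  by apply: nbrs2_third; rewrite // -?nbrs3_nbrs2 // eq_sym.
have [u2 r3u] := nbrs2P ur r33.
have up : u != p by apply: contraNneq r3p => <-.
have ut : u != partner p by apply: contraNneq r3p => e; rewrite np -e.
have q1u := hatp_nonpartner_le q12 u2 uq1 _ (common_gt0 r3q1 r3u).
have q2u := hatp_nonpartner_le q22 u2 uq2 _ (common_gt0 r3q2 r3u).
rewrite -q2E uq2 !hs // in q1u; rewrite q2E partnerK // uq1 -q2E !hs // in q2u.
have pu := hatp_nonpartner_le0 p2 u2 up ut.
have tu : hatp (partner p) u <= 0 by apply: hatp_nonpartner_le0; rewrite ?partnerK.
have qq : hatp q1 q2 <= 1.
  by rewrite q2E hatp_partner // !hs //; move: (common_partner q12); clear; lia.
have := @hat_pos p [:: partner p; q1; q2; u] (partner u).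
rewrite /= p2 q12 t2 q22 u2 partner_lvl2 // !inE !negb_or partner_neq // partner_eq // ut partner_inj // up.
rewrite partner_eq // -q2E uq2 q2E partner_inj // uq1 -q2E.
move=> /(_ isT isT isT); rewrite !big_cons !big_nil !h1 // !hs //.
rewrite [hatp (partner p) p]hatpC [hatp q1 p]hatpC [hatp q2 p]hatpC [hatp q1 (partner p)]hatpC [hatp q2 (partner p)]hatpC [hatp q2 q1]hatpC.
rewrite [hatp u p]hatpC [hatp u (partner p)]hatpC [hatp u q1]hatpC [hatp u q2]hatpC.
move: (q1u isT) (q2u isT) hpt hpq1 hpq2 htq1 htq2 qq pu tu; clear; lia.
Qed.
End Tight.

(** * Cartan data *)

(** The combinatorial content of an irreducible reduced root system: cartan a b
is the Cartan integer of the root a and the coroot of b, srefl a b is the image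
of b under the reflection in a, and sqlen is half the squared length, normalised
so that short roots have value 1.  The axioms are symmetric under exchanging
roots and coroots.  [gram_null] expresses that the Gram form is positive
semidefinite, with radical the relations between the roots; it is stated for
families since reflecting some members of a family may create repetitions. *)
Record cartan_datum := CartanDatum {
  droot : finType;
  cartan : droot -> droot -> int;
  srefl : droot -> droot -> droot;
  sqlen : droot -> int;
  ratio : int;
  ratio_cases : ratio = 2 \/ ratio = 3;
  sqlen_cases : forall a, sqlen a = 1 \/ sqlen a = ratio;
  cartan_diag : forall a, cartan a a = 2;
  cartan_reflL : forall a b c, cartan (srefl a b) c = cartan b c - cartan b a * cartan a c;
  cartan_reflR : forall a b c, cartan c (srefl a b) = cartan c b - cartan a b * cartan c a;
  sreflK : forall a, involutive (srefl a);
  sqlen_refl : forall a b, sqlen (srefl a b) = sqlen b;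
  cartan_sym : forall a b, cartan a b * sqlen b = cartan b a * sqlen a;
  gram_null : forall (I : finType) (p : I -> droot) (x : I -> int),
    \sum_i \sum_j x i * x j * (cartan (p i) (p j) * sqlen (p j)) <= 0 ->
    forall t, \sum_i x i * cartan (p i) t = 0;
  cartan_prod4 : forall a b, cartan a b * cartan b a = 4 -> b = a \/ b = srefl a a
}.
Arguments srefl {_} _ _.
Arguments sqlen {_} _.
Arguments cartan {_} _ _.

Section CartanDatumTheory.
Variable D : cartan_datum.
Implicit Types a b t : droot D.

Lemma sqlen_gt0 a : 0 < sqlen a.
Proof. by case: (sqlen_cases a) => -> //; case: (ratio_cases D) => ->. Qed.

Lemma cartan_negl a t : cartan (srefl a a) t = - cartan a t.
Proof. by rewrite cartan_reflL cartan_diag; lia. Qed.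

Lemma cartan_bound a b : cartan a b * cartan b a = 4 \/ 0 <= cartan a b * cartan b a < 4.
Proof.
have fa := sqlen_gt0 a; have fb := sqlen_gt0 b; have e := cartan_sym a b.
have sg : 0 <= cartan a b * cartan b a by nia.
have [lt|ge] := ltP (cartan a b * cartan b a) 4; first by right; rewrite sg.
(* Up to a factor, the vector x is the component of a orthogonal to b. *)
left; pose p (i : bool) := if i then a else b.
pose x (i : bool) := if i then 2 * sqlen b else - (cartan a b * sqlen b).
have := @gram_null D bool p x; rewrite !big_bool /x /p !cartan_diag => rel.
have /rel/(_ a) : 2 * sqlen b * (2 * sqlen b) * (2 * sqlen a) + 2 * sqlen b * - (cartan a b * sqlen b) * (cartan a b * sqlen b) +
    (- (cartan a b * sqlen b) * (2 * sqlen b) * (cartan b a * sqlen a) + - (cartan a b * sqlen b) * - (cartan a b * sqlen b) * (2 * sqlen b)) <= 0.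
  rewrite -e; set g := cartan a b * sqlen b.
  have gg : g * g = cartan a b * cartan b a * (sqlen a * sqlen b) by rewrite {2}/g e /g; ring.
  have -> : 2 * sqlen b * (2 * sqlen b) * (2 * sqlen a) + 2 * sqlen b * - g * g + (- g * (2 * sqlen b) * g + - g * - g * (2 * sqlen b))
    = 2 * sqlen b * (4 * (sqlen a * sqlen b) - g * g) by ring.
  rewrite gg; have : 0 < sqlen a * sqlen b by rewrite mulr_gt0.
  nia.
rewrite big_bool /= cartan_diag => h; apply: (@mulfI _ (sqlen b)); first by rewrite gt_eqF.
by move: h; lia.
Qed.

Lemma gram_values a b : b <> a -> b <> srefl a a ->
  let g := if (sqlen a == 1) && (sqlen b == 1) then 1 else ratio D in
  [\/ cartan a b * sqlen b = 0, cartan a b * sqlen b = g | cartan a b * sqlen b = - g].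
Proof.
move=> ba bsa; case: (cartan_bound a b) => [/cartan_prod4[]//|/andP[ge lt]].
have k1 : (ratio D == 1) = false by case: (ratio_cases D) => ->.
have := cartan_sym a b; case: (sqlen_cases a) => fa; case: (sqlen_cases b) => fb; rewrite fa fb ?k1 /=.
- rewrite !mulr1 => e; have : cartan a b = 0 \/ cartan a b = 1 \/ cartan a b = -1 by nia.
  by case=> [->|[]->]; [apply: Or31|apply: Or32|apply: Or33].
- rewrite mulr1 => e; have : cartan a b = 0 \/ cartan a b = 1 \/ cartan a b = -1.
    by case: (ratio_cases D) e => ->; nia.
  by case=> [->|[]->]; [apply: Or31|apply: Or32|apply: Or33]; rewrite ?mul0r ?mul1r ?mulN1r.
- rewrite mulr1 => e; have : cartan b a = 0 \/ cartan b a = 1 \/ cartan b a = -1.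
    by case: (ratio_cases D) e => ->; nia.
  by rewrite e; case=> [->|[]->]; [apply: Or31|apply: Or32|apply: Or33];
    rewrite ?mul0r ?mul1r ?mulN1r.
move=> e; have : cartan a b = 0 \/ cartan a b = 1 \/ cartan a b = -1.
  by case: (ratio_cases D) e => ->; nia.
by case: (ratio_cases D) => -> /=; case=> [->|[]->]; [apply: Or31|apply: Or32|apply: Or33|apply: Or31|apply: Or32|apply: Or33].
Qed.
End CartanDatumTheory.

(** * Short roots in the closure of a set of roots *)
Inductive rclosure (T : finType) (srefl : T -> T -> T) (P : {set T}) : T -> Prop :=
  | rclosure_gen a : a \in P -> rclosure srefl P a
  | rclosure_refl a b : rclosure srefl P a -> rclosure srefl P b -> rclosure srefl P (srefl a b).

Section Closure.
Variable D : cartan_datum.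
Implicit Types a b t : droot D.

(** Induction on the length of the expression of v as an integral combination.
As v has positive norm, some term of the sum has a positive inner product with v.
Since v is short, either v is this root up to sign, or reflecting v in it removes
one copy of this term, and v is recovered by reflecting back. *)
Lemma short_in_rclosure (P : {set droot D}) (I : finType) (p : I -> droot D) (x : I -> int) v :
  (forall i, x i != 0 -> rclosure srefl P (p i)) -> sqlen v = 1 ->
  (forall t, cartan v t = \sum_i x i * cartan (p i) t) -> rclosure srefl P v.
Proof.
have [m] := ubnP (\sum_i `|x i|)%N; elim: m x v => // m IH x v; rewrite ltnS => le px fv vE.
have [i xi] : exists i, 0 < x i * cartan (p i) v.
  apply/existsP; apply: contraT; rewrite negb_exists => /forallP no.
  suff: cartan v v <= 0 by rewrite cartan_diag.
  by rewrite vE sumr_le0 // => i _; rewrite leNgt.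
have cpi : rclosure srefl P (p i) by apply: px; apply: contraTneq xi => ->; rewrite mul0r.
have [nn4|/andP[nn0 nn4]] := cartan_bound (p i) v.
  by case: (cartan_prod4 nn4) => ->; [|exact: rclosure_refl].
have e := cartan_sym (p i) v; rewrite fv mulr1 in e.
(* As v is short, m' is 1 or -1, with the sign of the coefficient of p i. *)
have fp := sqlen_gt0 (p i); pose m' := cartan v (p i).
have m'E : (0 < x i /\ m' = 1) \/ (x i < 0 /\ m' = -1).
  rewrite e in xi nn4; rewrite /m'; move: xi nn4 fp.
  move: (x i) (sqlen (p i)) (cartan v (p i)) => y g z yzg zzg g0.
  have zz : z * z < 4 by apply: le_lt_trans zzg; clear -g0; nia.
  have z3 : -2 < z < 2 by clear -zz; nia.
  have z0 : z <> 0 by move=> z0; rewrite z0 mul0r mulr0 in yzg.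
  have [ez|ez] : z = 1 \/ z = -1 by clear -z3 z0; lia.
    by left; split=> //; rewrite ez mul1r in yzg; clear -yzg g0; nia.
  by right; split=> //; rewrite ez in yzg; clear -yzg g0; nia.
rewrite -[v](sreflK (p i)); apply: rclosure_refl => //.
pose x' j := if j == i then x i - m' else x j.
apply: (IH x') => [|j|  |t].
- apply: leq_trans le; rewrite (bigD1 i) //= [X in (_ < X)%N](bigD1 i) //=.
  rewrite /x' eqxx -addSn leq_add //; first by move: m'E; clear; lia.
  by rewrite leq_eqVlt (eq_bigr (fun j => `|x j|%N)) ?eqxx // => j /negPf->.
- by rewrite /x'; case: (j =P i) => [->|_] //; apply: px.
- by rewrite sqlen_refl.
rewrite cartan_reflL vE (bigD1 i) //= [RHS](bigD1 i) //= /x' eqxx -/m'.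
rewrite [X in _ = _ + X](eq_bigr (fun j => x j * cartan (p j) t)) => [|j /negPf->//].
by rewrite /m'; ring.
Qed.
End Closure.

(** * Reflecting a circuit *)
Section Circuits.
Variables (D : cartan_datum) (I : finType).
Implicit Types (p : I -> droot D) (c x : I -> int).

Definition relation p x := forall t, \sum_i x i * cartan (p i) t = 0.

(** A relation of minimal support, which is therefore unique on its support up to
proportionality. *)
Definition circuit p c := [/\ relation p c, exists i, c i != 0 &
  forall x, (forall i, c i = 0 -> x i = 0) -> relation p x ->
    forall i j, x i * c j = x j * c i].

(** The values of d have no common divisor. *)
Definition primitive (d : I -> int) := forall e : int, (forall i, (e %| d i)%Z) -> `|e| = 1.

Variables (p : I -> droot D) (i0 : I) (S : seq I).
Hypothesis S_uniq : uniq (i0 :: S).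

(** The roots in S are reflected in the root of index i0.  As the reflection
changes them by multiples of this root only, the coefficients of a relation
stay the same except at i0. *)
Definition move_fam j := if j \in S then srefl (p i0) (p j) else p j.
Definition move_coef c j := if j == i0 then c i0 + \sum_(l <- S) c l * cartan (p l) (p i0) else c j.
Definition unmove_coef c j := if j == i0 then c i0 - \sum_(l <- S) c l * cartan (p l) (p i0) else c j.

Lemma notin_S : i0 \notin S. Proof. by case/andP: S_uniq. Qed.

Lemma neq_S l : l \in S -> (l == i0) = false.
Proof. by move=> lS; apply: contraTF lS => /eqP->; exact: notin_S. Qed.

Lemma unmoveK c : move_coef (unmove_coef c) =1 c.
Proof.
move=> j; rewrite {1}/move_coef; case: (j =P i0) => [->|/eqP/negPf ji]; last first.
  by rewrite /unmove_coef ji.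
rewrite (eq_big_seq (fun l => c l * cartan (p l) (p i0))) => [|l /neq_S li]; last first.
  by rewrite /unmove_coef li.
by rewrite /unmove_coef eqxx subrK.
Qed.

Lemma move_sum c t :
  \sum_i move_coef c i * cartan (move_fam i) t = \sum_i c i * cartan (p i) t.
Proof.
have -> : \sum_i move_coef c i * cartan (move_fam i) t =
  \sum_i (c i * cartan (p i) t + ((i == i0)%:R * (\sum_(l <- S) c l * cartan (p l) (p i0)) * cartan (p i0) t
    - (i \in S)%:R * c i * cartan (p i) (p i0) * cartan (p i0) t)).
  apply: eq_bigr => i _; rewrite /move_coef /move_fam.
  case: (i =P i0) => [->|ni]; first by rewrite (negPf notin_S) /=; ring.
  by case: ifP => _; rewrite ?cartan_reflL /=; ring.
rewrite big_split /= sumrB [X in _ + (X - _)](bigD1 i0) //= eqxx.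
rewrite [X in _ + (_ + X - _)]big1 => [|i /negPf->]; last by rewrite !mul0r.
rewrite [X in _ + (_ - X)](_ : _ = (\sum_(l <- S) c l * cartan (p l) (p i0)) * cartan (p i0) t).
  by rewrite mul1r addr0 subrr addr0.
rewrite mulr_suml [RHS]big_uniq /=; last by case/andP: S_uniq.
rewrite [RHS]big_mkcond; apply: eq_bigr => i _.
by case: (i \in S); rewrite ?mul1r ?mul0r.
Qed.

Lemma unmove_sum c t :
  \sum_i unmove_coef c i * cartan (p i) t = \sum_i c i * cartan (move_fam i) t.
Proof. by rewrite -move_sum; apply: eq_bigr => i _; rewrite unmoveK. Qed.

Lemma move_sqlen j : sqlen (move_fam j) = sqlen (p j).
Proof. by rewrite /move_fam; case: ifP; rewrite ?sqlen_refl. Qed.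

Lemma move_circuit c : circuit p c -> c i0 != 0 -> (exists i, move_coef c i != 0) ->
  circuit move_fam (move_coef c).
Proof.
move=> [rel _ un] c0 nz; split=> // [t|x' supp rel' i j]; first by rewrite move_sum.
have relx : relation p (unmove_coef x') by move=> t; rewrite unmove_sum.
have suppx i' : c i' = 0 -> unmove_coef x' i' = 0.
  rewrite /unmove_coef; case: (i' =P i0) => [->|/eqP/negPf ne] ci; first by rewrite ci eqxx in c0.
  by apply: supp; rewrite /move_coef ne.
have un1 a b : a != i0 -> b != i0 -> x' a * c b = x' b * c a.
  by move=> /negPf na /negPf nb; have := un _ suppx relx a b; rewrite /unmove_coef na nb.
have un2 b : b != i0 -> x' i0 * c b = x' b * move_coef c i0.
  move=> nb; have := un _ suppx relx i0 b; rewrite /unmove_coef /move_coef eqxx (negPf nb).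
  rewrite mulrBl mulrDr mulr_suml mulr_sumr => /eqP; rewrite subr_eq => /eqP->.
  congr (_ + _); apply: eq_big_seq => l lS.
  by rewrite mulrAC un1 ?(neq_S lS) // mulrA.
have mE b : b != i0 -> move_coef c b = c b by rewrite /move_coef => /negPf->.
have [->|ni] := eqVneq i i0; have [->|nj] := eqVneq j i0; rewrite ?[move_coef c j]mE ?[move_coef c i]mE //.
- by rewrite un2.
- by rewrite un2.
by rewrite un1.
Qed.

Lemma move_sqlen0 c : move_coef c i0 * sqlen (p i0) =
  c i0 * sqlen (p i0) + \sum_(l <- S) c l * (cartan (p l) (p i0) * sqlen (p i0)).
Proof.
rewrite /move_coef eqxx mulrDl mulr_suml; congr (_ + _).
by apply: eq_bigr => l _; rewrite mulrA.
Qed.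

Lemma move_primitive c : primitive (fun i => c i * sqlen (p i)) ->
  primitive (fun i => move_coef c i * sqlen (move_fam i)).
Proof.
move=> prim e de; apply: prim => i.
have dc j : j != i0 -> (e %| c j * sqlen (p j))%Z.
  by move=> /negPf nj; have := de j; rewrite move_sqlen /move_coef nj.
have [->|/dc//] := eqVneq i i0.
have := de i0; rewrite move_sqlen move_sqlen0 => h.
have e0 : (e %| \sum_(l <- S) c l * (cartan (p l) (p i0) * sqlen (p i0)))%Z.
  rewrite big_seq; apply: rpred_sum => l lS.
  by rewrite cartan_sym mulrCA dvdz_mull // dc // neq_S.
by rewrite -[c i0 * _](addrK (\sum_(l <- S) c l * (cartan (p l) (p i0) * sqlen (p i0)))) rpredB.
Qed.
End Circuits.

(** * Circuits have a unit coefficient *)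
Section UnitCoef.
Variables (D : cartan_datum) (I : finType).
Implicit Types (p : I -> droot D) (c x : I -> int).

(** Replacing roots by their opposites makes the coefficients nonnegative. *)
Definition flip p c i := if c i < 0 then srefl (p i) (p i) else p i.

Lemma flip_sum p c x t : \sum_i x i * cartan (flip p c i) t =
  \sum_i (if c i < 0 then - x i else x i) * cartan (p i) t.
Proof. by apply: eq_bigr => i _; rewrite /flip; case: ifP; rewrite ?cartan_negl ?mulrN ?mulNr. Qed.

Lemma flip_sqlen p c i : sqlen (flip p c i) = sqlen (p i).
Proof. by rewrite /flip; case: ifP; rewrite ?sqlen_refl. Qed.

Lemma flip_circuit p c : circuit p c -> circuit (flip p c) (fun i => `|c i|).
Proof.
move=> [rel nz un]; split=> [t||x supp relx i j].
- rewrite flip_sum -[RHS](rel t); apply: eq_bigr => i _.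
  by case: ltP => ci; [rewrite ltr0_norm ?opprK | rewrite ger0_norm].
- by have [i ci] := nz; exists i; rewrite normr_eq0.
have := un (fun i => if c i < 0 then - x i else x i) _ _ i j.
have sx l : c l = 0 -> (if c l < 0 then - x l else x l) = 0.
  by move=> cl; rewrite cl ltxx; apply: supp; rewrite cl normr0.
move/(_ sx); have relx' : relation p (fun i => if c i < 0 then - x i else x i).
  by move=> t; rewrite -flip_sum.
move=> /(_ relx').
case: (ltP (c i)) => ci; case: (ltP (c j)) => cj; clear -ci cj; lia.
Qed.

(** A repetition up to sign is itself a relation, so it is the whole circuit, with
two coefficients which are equal up to sign and hence units by primitivity. *)
Lemma same_root_unit p c i j (e : int) : circuit p c -> primitive (fun i => c i * sqlen (p i)) ->
  i != j -> c i != 0 -> c j != 0 -> e = 1 \/ e = -1 -> (forall t, cartan (p j) t = e * cartan (p i) t) ->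
  sqlen (p i) = sqlen (p j) -> `|c i * sqlen (p i)| = 1.
Proof.
move=> [rel _ un] prim ij ci cj eE ne fe.
pose x l : int := if l == i then e else if l == j then -1 else 0.
have xi : x i = e by rewrite /x eqxx.
have xj : x j = -1 by rewrite /x eq_sym (negPf ij) eqxx.
have x0 l : l != i -> l != j -> x l = 0 by rewrite /x => /negPf-> /negPf->.
have relx : relation p x.
  move=> t; rewrite (bigD1 i) //= (bigD1 j) /=; last by rewrite eq_sym.
  rewrite big1 => [|l /andP[li lj]]; last by rewrite x0 ?mul0r.
  by rewrite xi xj ne; ring.
have suppx l : c l = 0 -> x l = 0.
  by move=> cl; apply: x0; [apply: contraNneq ci | apply: contraNneq cj] => <-; rewrite cl.
have {}un := un x suppx relx.
apply: prim => l; have [->|li] := eqVneq l i; first exact: dvdzz.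
have := un l i; rewrite xi; have [->|lj] := eqVneq l j.
  rewrite xj -fe => h; have -> : c j = - e * c i by case: eE h => ->; clear; lia.
  by rewrite -mulrA dvdz_mull.
rewrite x0 // mul0r => h; suff -> : c l = 0 by rewrite mul0r dvdz0.
by case: eE h => ->; clear; lia.
Qed.

Definition ell1 (d : I -> int) : nat := (\sum_i `|d i|)%N.

(** The induction step of the descent: without a unit coefficient, the circuit
satisfies the hypotheses of [no_tight_circuit].  A move that decreases d at one
index yields a smaller circuit, whose unit coefficient can be neither at this
index, where d is not a unit, nor at another one, where d has not changed. *)
Lemma unit_step p c : circuit p c -> primitive (fun i => c i * sqlen (p i)) ->
  (forall i, 0 <= c i) ->
  (forall p' c', circuit p' c' -> primitive (fun i => c' i * sqlen (p' i)) ->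
    (ell1 (fun i => c' i * sqlen (p' i))%R < ell1 (fun i => c i * sqlen (p i))%R)%N ->
    exists i, `|c' i * sqlen (p' i)| = 1) ->
  exists i, `|c i * sqlen (p i)| = 1.
Proof.
move=> circ prim c0 IH; apply: contrapT => no.
have [rel [i1 ci1] un] := circ.
have nou i : c i * sqlen (p i) <> 1 by move=> e; apply: no; exists i; rewrite e.
have cn i : 0 < c i -> c i != 0 by move=> ci; rewrite gt_eqF.
apply: (@no_tight_circuit I (ratio D) (fun i => sqlen (p i)) c (fun i j => cartan (p i) (p j) * sqlen (p j))).
- exact: ratio_cases.
- by move=> i; apply: sqlen_cases.
- exact: c0.
- by exists i1; rewrite lt_neqAle c0 eq_sym ci1.
- by move=> i j; rewrite cartan_sym.
- by move=> i; rewrite cartan_diag.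
- move=> i j ij /cn ci /cn cj; apply: gram_values => e; apply: no; exists i.
    by apply: (same_root_unit (j := j) (e := 1) circ prim); rewrite ?e //; [left | move=> t; rewrite mul1r].
  apply: (same_root_unit (j := j) (e := -1) circ prim); rewrite ?e ?sqlen_refl //; first by right.
  by move=> t; rewrite cartan_negl mulN1r.
- move=> i; transitivity ((\sum_j c j * cartan (p j) (p i)) * sqlen (p i)); last by rewrite rel mul0r.
  rewrite mulr_suml; by apply: eq_bigr => j _; rewrite mulrA.
- move=> x supp xx; apply: un => // t; exact: gram_null xx t.
- move=> i l ul ci sg; apply: contrapT => /not_orP[n1 /negP]; rewrite -ltNge => lt.
  have di : c i * sqlen (p i) - sg = move_coef p i l c i * sqlen (p i).
    rewrite move_sqlen0; congr (_ + _); rewrite /sg -sumrN; apply: eq_bigr => j _.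
    by rewrite /weight opprK.
  have nE j : j != i -> move_coef p i l c j = c j by rewrite /move_coef => /negPf->.
  have cs := move_circuit ul circ (cn _ ci).
  have nz : exists j, move_coef p i l c j != 0.
    have [j ji cj] : exists2 j, j != i & c j != 0.
      apply: contrapT => no2; have := rel (p i); rewrite (bigD1 i) //= cartan_diag big1 => [|j ji].
        by rewrite addr0; lia.
      have [-> | cj] := eqVneq (c j) 0; first by rewrite mul0r.
      by case: no2; exists j.
    by exists j; rewrite nE.
  have [||j] := IH _ _ (cs nz).
  + exact: move_primitive.
  + rewrite /ell1 (bigD1 i) //= [X in (_ < X)%N](bigD1 i) //= -addSn leq_add //.
      by rewrite move_sqlen -di; move: lt; lia.
    by rewrite leq_eqVlt; apply/orP; left; apply/eqP/eq_bigr => j ji; rewrite move_sqlen nE.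
  rewrite move_sqlen; have [->|ji] := eqVneq j i; first by rewrite -di.
  by rewrite nE // => e; apply: no; exists j.
- exact: nou.
Qed.

Lemma exists_unit p c : circuit p c -> primitive (fun i => c i * sqlen (p i)) ->
  exists i, `|c i * sqlen (p i)| = 1.
Proof.
have [m] := ubnP (ell1 (fun i => c i * sqlen (p i))); elim: m p c => // m IH p c; rewrite ltnS => le circ prim.
have nrm i : `| (`|c i|) * sqlen (p i)| = `|c i * sqlen (p i)| by rewrite !normrM normr_id.
have [||||i] := @unit_step (flip p c) (fun i => `|c i|).
- exact: flip_circuit.
- move=> e de; apply: prim => i; have := de i; rewrite flip_sqlen !dvdzE.
  by rewrite !abszM absz_nat.
- by move=> i; apply: normr_ge0.
- move=> p' c' circ' prim' lt; apply: (IH p') => //; apply: leq_trans lt _.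
  apply: leq_trans le; apply: leq_sum => i _; rewrite flip_sqlen.
  by have := nrm i; lia.
by rewrite flip_sqlen nrm => e; exists i.
Qed.
End UnitCoef.

(** * Duality *)
Section Dual.
Variable D : cartan_datum.
Implicit Types a b t : droot D.

Definition dual_sqlen a : int := if sqlen a == 1 then ratio D else 1.

Lemma sqlen_dual a : sqlen a * dual_sqlen a = ratio D.
Proof.
rewrite /dual_sqlen; case: (sqlen_cases a) => fa; first by rewrite fa eqxx mul1r.
by rewrite ifF ?mulr1 // fa; case: (ratio_cases D) => ->.
Qed.

Lemma ratio_neq0 : ratio D != 0. Proof. by case: (ratio_cases D) => ->. Qed.

Lemma dual_cartan_sym a b : cartan b a * dual_sqlen b = cartan a b * dual_sqlen a.
Proof.
apply: (mulfI ratio_neq0); rewrite -{1}(sqlen_dual a) -(sqlen_dual b).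
have -> : sqlen a * dual_sqlen a * (cartan b a * dual_sqlen b) = cartan b a * sqlen a * (dual_sqlen a * dual_sqlen b) by ring.
by rewrite -cartan_sym; ring.
Qed.

Lemma dual_relation (I : finType) (p : I -> droot D) (x : I -> int) :
  (forall t, \sum_i (x i * dual_sqlen (p i)) * cartan (p i) t = 0) <->
  (forall t, \sum_i x i * cartan t (p i) = 0).
Proof.
have e t : sqlen t * (\sum_i (x i * dual_sqlen (p i)) * cartan (p i) t) = ratio D * \sum_i x i * cartan t (p i).
  rewrite !mulr_sumr; apply: eq_bigr => i _; rewrite -(sqlen_dual (p i)).
  have -> : sqlen t * (x i * dual_sqlen (p i) * cartan (p i) t) = x i * dual_sqlen (p i) * (cartan (p i) t * sqlen t) by ring.
  by rewrite cartan_sym; ring.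
split=> rel t.
  by apply: (mulfI ratio_neq0); rewrite -e rel !mulr0.
by apply: (@mulfI _ (sqlen t)); rewrite ?gt_eqF ?sqlen_gt0 // e rel !mulr0.
Qed.

Lemma dual_psd (I : finType) (p : I -> droot D) (x : I -> int) :
    \sum_i \sum_j x i * x j * (cartan (p j) (p i) * dual_sqlen (p j)) <= 0 ->
    forall t, \sum_i x i * cartan t (p i) = 0.
Proof.
move=> le; apply/dual_relation; apply: gram_null.
suff -> : \sum_i \sum_j x i * dual_sqlen (p i) * (x j * dual_sqlen (p j)) * (cartan (p i) (p j) * sqlen (p j)) =
  ratio D * \sum_i \sum_j x i * x j * (cartan (p j) (p i) * dual_sqlen (p j)).
  by case: (ratio_cases D) => ->; lia.
rewrite mulr_sumr; apply: eq_bigr => i _; rewrite mulr_sumr; apply: eq_bigr => j _.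
rewrite -(sqlen_dual (p j)) dual_cartan_sym; ring.
Qed.

Definition dual : cartan_datum.
Proof.
refine (@CartanDatum (droot D) (fun a b => cartan b a) (@srefl D) dual_sqlen (ratio D) (ratio_cases D)
  _ _ _ _ (@sreflK D) _ _ dual_psd _).
- by move=> a; rewrite /dual_sqlen; case: ifP; [right|left].
- exact: cartan_diag.
- by move=> a b c; rewrite cartan_reflR.
- by move=> a b c; rewrite cartan_reflL.
- by move=> a b; rewrite /dual_sqlen sqlen_refl.
- exact: dual_cartan_sym.
by move=> a b; rewrite mulrC; apply: cartan_prod4.
Defined.

(** The coefficient of the coroot of p i in the relation is c i * f i, up to the
common factor ratio. *)
Lemma dual_circuit (I : finType) (p : I -> droot D) (c c' : I -> int) :
  (forall i, c i * sqlen (p i) = ratio D * c' i) -> circuit p c ->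
  @circuit dual I p c'.
Proof.
move=> cE [rel [i ci] un].
have c'E j : c' j * dual_sqlen (p j) = c j.
  by apply: (mulfI ratio_neq0); rewrite mulrA -cE -mulrA sqlen_dual mulrC.
have df j : dual_sqlen (p j) != 0.
  by apply: contraNneq ratio_neq0 => e; rewrite -(sqlen_dual (p j)) e mulr0.
split=> [||x supp relx j l].
- by apply/dual_relation => t; rewrite -[RHS](rel t); apply: eq_bigr => j _; rewrite c'E.
- by exists i; apply: contraNneq ci => e; rewrite -c'E e mul0r.
have := un (fun j => x j * dual_sqlen (p j)) _ _ j l.
have sx m : c m = 0 -> x m * dual_sqlen (p m) = 0.
  move/eqP; rewrite -c'E mulf_eq0 (negPf (df m)) orbF => /eqP/supp->.
  by rewrite mul0r.
move=> /(_ sx); rewrite -!c'E => /(_ _)/= h.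
have := h (proj2 (dual_relation p x) relx) => e.
apply: (mulIf (df j)); apply: (mulIf (df l)).
by move: e; clear; lia.
Qed.

End Dual.

(** * Dependent sets of roots are redundant *)
Section Exists.
Variables (D : cartan_datum) (I : finType) (p : I -> droot D).
Implicit Types x c : I -> int.

(** If y is a relation on the support of x which is not proportional to x, then a
combination of x and y has a smaller support. *)
Lemma circuit_exists x : relation p x -> (exists i, x i != 0) ->
  exists2 c, circuit p c & forall i, x i = 0 -> c i = 0.
Proof.
have [m] := ubnP #|[set i | x i != 0]|; elim: m x => // m IH x; rewrite ltnS => le rel nz.
have [un|/existsNP[y]] := pselect (forall y, (forall i, x i = 0 -> y i = 0) -> relation p y ->
    forall i j, y i * x j = y j * x i).
  by exists x.
move=> /not_implyP[suppy /not_implyP[rely /existsNP[i /existsNP[j ne]]]].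
pose z l := y i * x l - x i * y l.
have zi : z i = 0 by rewrite /z; ring.
have zx l : x l = 0 -> z l = 0 by move=> xl; rewrite /z xl (suppy _ xl) !mulr0 subrr.
have xi : x i != 0.
  by apply/eqP => xi; apply: ne; rewrite xi (suppy _ xi) mul0r mulr0.
have [|||c cc cz] := IH z.
- apply: leq_trans le; apply: proper_card; apply/properP; split.
    by apply/subsetP => l; rewrite !inE; apply: contraNneq => /zx->.
  by exists i; rewrite !inE ?zi ?eqxx.
- move=> t; transitivity (y i * (\sum_l x l * cartan (p l) t) - x i * \sum_l y l * cartan (p l) t).
    by rewrite !mulr_sumr -sumrB; apply: eq_bigr => l _; rewrite /z; ring.
  by rewrite rel rely !mulr0 subrr.
- exists j; rewrite /z subr_eq0; apply: contra_notN ne => /eqP->; exact: mulrC.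
by exists c => // l /zx/cz.
Qed.

Lemma circuit_primitive c : circuit p c ->
  exists c', [/\ circuit p c', forall i, c i = 0 -> c' i = 0 & primitive c'].
Proof.
have [m] := ubnP (ell1 c); elim: m c => // m IH c; rewrite ltnS => le circ.
have [prim|/existsNP[e /not_implyP[ec e1]]] := pselect (primitive c); first by exists c.
have [rel [i ci] un] := circ.
have e0 : e != 0 by apply: contraNneq ci => e0; have := ec i; rewrite e0 dvd0z.
pose c' l := (c l %/ e)%Z.
have cE l : c l = c' l * e by rewrite divzK.
have [||c'' [h1 h2 h3]] := IH c'.
- apply: leq_trans le; rewrite /ell1 (bigD1 i) //= [X in (_ < X)%N](bigD1 i) //= -addSn leq_add //.
    by move: ci; rewrite cE; move: e0 e1; clear; nia.
  by apply: leq_sum => l _; rewrite cE; move: e0; clear; nia.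
- split=> [t||x supp relx j l].
  + apply: (mulIf e0); rewrite mul0r mulr_suml -[RHS](rel t); apply: eq_bigr => l _.
    by rewrite cE; ring.
  + by exists i; apply: contraNneq ci; rewrite cE => ->; rewrite mul0r.
  apply: (mulIf e0); rewrite -!mulrA -!cE; apply: un => // l'.
  by rewrite cE => /eqP; rewrite mulf_eq0 (negPf e0) orbF => /eqP/supp.
exists c''; split=> // l cl; apply: h2; apply: (mulIf e0); by rewrite -cE cl mul0r.
Qed.
End Exists.

Lemma unit_redundant (D : cartan_datum) (P : {set droot D}) (c : droot D -> int) a :
  circuit id c -> (forall b, c b != 0 -> b \in P) -> `|c a * sqlen a| = 1 ->
  a \in P /\ rclosure srefl (P :\ a) a.
Proof.
move=> [rel _ _] supp u.
have ca : c a != 0 by apply: contraPneq u => ->; rewrite mul0r normr0.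
split; first exact: supp.
have fa : sqlen a = 1.
  by case: (sqlen_cases a) => // fa; move: u; rewrite fa; case: (ratio_cases D) => ->; clear; lia.
have c1 : c a * c a = 1.
  by have [->|->] : c a = 1 \/ c a = -1 by move: u; rewrite fa; clear; lia.
apply: (@short_in_rclosure D _ (droot D) id (fun b => if b == a then 0 else - c a * c b)) => // [b|t].
  case: (eqVneq b a) => [|ba]; first by rewrite eqxx.
  rewrite mulf_eq0 oppr_eq0 (negPf ca) /= => cb.
  by apply: rclosure_gen; rewrite !inE ba supp.
rewrite (bigD1 a) //= eqxx mul0r add0r.
rewrite (eq_bigr (fun b => - c a * (c b * cartan b t))) => [|b /negPf->]; last by rewrite mulrA.
rewrite -mulr_sumr; have := rel t; rewrite (bigD1 a) //= => /eqP; rewrite addrC addr_eq0 => /eqP->.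
by rewrite mulrNN mulrA c1 mul1r.
Qed.

(** For a primitive circuit c, a common divisor of the integers c i * f i divides
ratio times every c i; as ratio is prime, either these integers are coprime, or
ratio divides all of them.  In the second case their quotients by ratio are the
coefficients of the relation between the coroots, and multiplied by the dual
lengths they give back the coprime integers c i. *)
Theorem dependent_redundant (D : cartan_datum) (P : {set droot D}) (x : droot D -> int) :
  (forall t, \sum_b x b * cartan b t = 0) -> (exists b, x b != 0) ->
  (forall b, x b != 0 -> b \in P) -> exists2 a, a \in P & rclosure srefl (P :\ a) a.
Proof.
move=> rel nz supp.
have [c0 circ0 c0x] := circuit_exists (p := id) rel nz.
have [c [circ cc0 prim]] := circuit_primitive circ0.
have csupp b : c b != 0 -> b \in P.
  by move=> cb; apply: supp; apply: contraNneq cb => /c0x/cc0->.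
have [prd|npr] := pselect (primitive (fun a => c a * sqlen a)).
  by have [a ua] := exists_unit circ prd; have [] := unit_redundant circ csupp ua; exists a.
have kd a : (ratio D %| c a * sqlen a)%Z.
  move: npr => /existsNP[e /not_implyP[ed e1]].
  apply/negPn/negP => nk; apply: e1; apply: prim => b.
  have ek : coprimez e (ratio D).
    have ke : ~~ (ratio D %| e)%Z by apply: contra nk => /dvdz_trans; apply.
    rewrite coprimez_sym coprimezE prime_coprime; last by case: (ratio_cases D) => ->.
    by rewrite -dvdzE.
  rewrite -(Gauss_dvdzl _ ek).
  by rewrite -(sqlen_dual b) mulrA; apply: dvdz_mulr.
pose c' a := (c a * sqlen a %/ ratio D)%Z.
have cE a : c a * sqlen a = ratio D * c' a by rewrite [RHS]mulrC divzK.
have circ' := dual_circuit (p := id) cE circ.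
have c'E a : c' a * dual_sqlen a = c a.
  by apply: (mulfI (ratio_neq0 D)); rewrite mulrA -cE -mulrA sqlen_dual mulrC.
have [|a ua] := exists_unit circ'.
  by move=> e ec; apply: prim => a; have := ec a; rewrite /= c'E.
have [|aP ca] := @unit_redundant (dual D) P c' a circ' _ ua; last by exists a.
move=> b cb; apply: csupp; apply: contraNneq cb => e.
have := cE b; rewrite e mul0r => /esym/eqP.
by rewrite mulf_eq0 (negPf (ratio_neq0 D)).
Qed.

(** * Reflections in a group generated by reflections *)
Lemma odd_card_fixed (T : finType) (Y : {set T}) (phi : T -> T) :
  {in Y, forall a, phi a \in Y} -> {in Y, forall a, phi (phi a) = a} ->
  odd #|Y| = odd #|[set a in Y | phi a == a]|.
Proof.
move=> pY pK.
pose Y1 := [set a in Y | (enum_rank a < enum_rank (phi a))%N].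
pose Y2 := [set a in Y | (enum_rank (phi a) < enum_rank a)%N].
have e : #|Y2| = #|Y1|.
  rewrite -(card_in_imset (f := phi) (D := Y1)); last first.
    by move=> a b; rewrite !inE => /andP[aY _] /andP[bY _] /(congr1 phi); rewrite !pK.
  apply: eq_card => a; apply/idP/imsetP => [|[b]]; rewrite !inE => /andP[aY lt].
    by exists (phi a); rewrite ?inE ?pK // pY.
  by move=> ->; rewrite pY // pK.
have dY : Y = [set a in Y | phi a == a] :|: (Y1 :|: Y2).
  apply/setP => a; rewrite !inE; case aY: (a \in Y) => //=.
  rewrite -neq_ltn; have [->|ne] := eqVneq (phi a) a => //=.
  by apply/esym; apply: contra_neq ne => /val_inj/enum_rank_inj.
have d1 : [disjoint [set a in Y | phi a == a] & Y1 :|: Y2].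
  rewrite disjoint_subset; apply/subsetP => a; rewrite !inE => /andP[-> /eqP->] /=.
  by rewrite ltnn.
have d2 : [disjoint Y1 & Y2].
  rewrite disjoint_subset; apply/subsetP => a; rewrite !inE => /andP[-> /=].
  by rewrite -leqNgt; exact: ltnW.
rewrite {1}dY !cardsU !disjoint_setI0 // !cards0 !subn0 e.
by rewrite addnn oddD odd_double addbF.
Qed.

Section Parity.
Variable D : cartan_datum.
Implicit Types a b p t : droot D.

Lemma cartan_inj a b : (forall t, cartan a t = cartan b t) -> a = b.
Proof.
move=> ab; have [|//|e] := @cartan_prod4 D a b; first by rewrite (ab b) -(ab a) !cartan_diag.
by have := ab a; rewrite e cartan_negl cartan_diag.
Qed.

Definition neg a := srefl a a.

Lemma negK : involutive neg.
Proof. by move=> a; apply: cartan_inj => t; rewrite !cartan_negl opprK. Qed.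

Lemma srefl_neg p a : srefl p (neg a) = neg (srefl p a).
Proof. by apply: cartan_inj => t; rewrite cartan_reflL !cartan_negl cartan_reflL; ring. Qed.

Lemma neg_neq a : neg a != a.
Proof. by apply/eqP => /(congr1 (fun b => cartan b a)); rewrite cartan_negl cartan_diag. Qed.

(** An arbitrary choice of one root in each pair of opposite roots. *)
Definition pos a := (enum_rank a < enum_rank (neg a))%N.

Lemma pos_neg a : pos (neg a) = ~~ pos a.
Proof.
rewrite /pos negK -leqNgt [RHS]leq_eqVlt; case: eqP => //= e.
by have := neg_neq a; rewrite (enum_rank_inj (ord_inj e)) eqxx.
Qed.

Definition absr a := if pos a then a else neg a.

Lemma pos_abs a : pos (absr a).
Proof. by rewrite /absr; case: ifP => // pa; rewrite pos_neg pa. Qed.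

Lemma abs_neg a : absr (neg a) = absr a.
Proof. by rewrite /absr pos_neg; case: (pos a) => //=; rewrite negK. Qed.

Variable B : {set droot D}.
Hypothesis B_stable : forall p a, a \in B -> srefl p a \in B.

Lemma B_neg a : (neg a \in B) = (a \in B).
Proof. by apply/idP/idP => [h|/B_stable->//]; rewrite -(negK a); apply: B_stable. Qed.

Lemma B_abs a : (absr a \in B) = (a \in B).
Proof. by rewrite /absr; case: ifP => // _; rewrite B_neg. Qed.

Lemma B_srefl p a : (srefl p a \in B) = (a \in B).
Proof. by apply/idP/idP => [/(B_stable p)|/B_stable->//]; rewrite sreflK. Qed.

(** A map that commutes with taking opposites permutes the lines spanned by the
roots of B; chi is the parity of the number of lines whose chosen orientation
is reversed. *)
Definition chi (g : droot D -> droot D) :=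
  \big[addb/false]_(a | (a \in B) && pos a) ~~ pos (g a).

(** Reversals are counted on the lines themselves, and the reflection in p
permutes these lines. *)
Lemma chi_comp (g : droot D -> droot D) p : (forall a, g (neg a) = neg (g a)) ->
  chi (fun a => g (srefl p a)) = chi (srefl p) (+) chi g.
Proof.
move=> gn; rewrite /chi.
have e a : ~~ pos (g (srefl p a)) = ~~ pos (srefl p a) (+) ~~ pos (g (absr (srefl p a))).
  rewrite /absr; case: (pos (srefl p a)) => //=.
  by rewrite gn pos_neg negbK.
under eq_bigr do rewrite e; rewrite big_split /=; congr (_ (+) _).
pose phi a := absr (srefl p a).
have phiK a : pos a -> phi (phi a) = a.
  move=> pa; rewrite /phi {2}/absr; case: ifP => _; rewrite ?srefl_neg ?abs_neg sreflK /absr pa //.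
rewrite [RHS](reindex_onto phi phi) /=; last by move=> a /andP[_ /phiK].
apply: eq_bigl => a; rewrite B_abs B_srefl pos_abs andbT.
case: (boolP (pos a)) => pa; first by rewrite phiK ?eqxx.
rewrite !andbF; apply/esym/negbTE; rewrite negb_and; apply/orP; right.
by apply: contraNneq pa => <-; exact: pos_abs.
Qed.

(** On the chosen roots a with s_p a negative, the map sending a to the opposite of
s_p a is an involution, whose only possible fixed point is the root p up to
sign. *)
Lemma chi_srefl p : chi (srefl p) = (p \in B).
Proof.
pose Y := [set a in B | pos a && ~~ pos (srefl p a)].
have oY : chi (srefl p) = odd #|Y|.
  rewrite /chi -sum1_card (big_morph odd oddD (erefl : odd 0 = false)).
  rewrite big_mkcond [RHS]big_mkcond; apply: eq_bigr => a _; rewrite !inE.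
  by case: (a \in B) => //=; case: (pos a) => //=; case: (pos (srefl p a)).
rewrite oY (@odd_card_fixed _ Y (fun a => neg (srefl p a))).
- have -> : [set a in Y | neg (srefl p a) == a] = if p \in B then [set absr p] else set0.
    have fx a : neg (srefl p a) = a -> p = a \/ p = neg a.
      move=> e; apply: cartan_prod4; have := cartan_reflL p a a; rewrite -{1}[srefl p a]negK e cartan_negl cartan_diag.
      by lia.
    apply/setP => a; rewrite !inE; apply/idP/idP => [/andP[/and3P[aB pa ps] /eqP /fx e]|].
      have pB : p \in B by case: e => -> //; rewrite B_neg.
      rewrite pB inE; apply/eqP; case: e => ->; rewrite ?abs_neg /absr pa //.
    case: ifP => pB; rewrite inE // => /eqP ->.
    have e : srefl p (absr p) = neg (absr p).
      by rewrite /absr; case: ifP => _ //; rewrite srefl_neg.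
    by rewrite B_abs pB pos_abs e pos_neg pos_abs negK eqxx.
  by case: ifP => _; rewrite ?cards1 ?cards0.
- move=> a; rewrite !inE => /and3P[aB pa ps].
  by rewrite B_neg B_srefl aB pos_neg ps srefl_neg sreflK -/(neg a) pos_neg pa.
by move=> a _; rewrite srefl_neg sreflK negK.
Qed.

Definition act (ps : seq (droot D)) a := foldl (fun x p => srefl p x) a ps.

Lemma act_neg ps a : act ps (neg a) = neg (act ps a).
Proof. by elim: ps a => //= p ps IH a; rewrite -IH srefl_neg. Qed.

Lemma chi_act ps : {in ps, forall p, p \notin B} -> chi (act ps) = false.
Proof.
elim: ps => [_|p ps IH pB]; first by rewrite /chi big1 // => a /andP[_ ->].
rewrite -[LHS]/(chi (fun a => act ps (srefl p a))) chi_comp; last exact: act_neg.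
rewrite chi_srefl (negPf (pB _ _)) ?inE ?eqxx //= IH // => q qps.
by apply: pB; rewrite inE qps orbT.
Qed.

(** The parity chi is even on the word and odd on the reflection. *)
Lemma reflection_not_word ps a : {in ps, forall p, p \notin B} -> a \in B ->
  (forall b, act ps b = srefl a b) -> False.
Proof.
move=> pB aB e; have := chi_act pB; rewrite (_ : act ps = srefl a); last exact/funext.
by rewrite chi_srefl aB.
Qed.
End Parity.

(** * Root lengths in an irreducible system *)
Section Lengths.
Variables (T : finType) (n : T -> T -> int) (s : T -> T -> T).
Hypothesis n_diag : forall a, n a a = 2.
Hypothesis n_sl : forall a b c, n (s a b) c = n b c - n b a * n a c.
Hypothesis n_sr : forall a b c, n c (s a b) = n c b - n a b * n c a.
Hypothesis sK : forall a, involutive (s a).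
Hypothesis proportional : forall a b, (forall t, 2 * n a t = n a b * n b t) ->
  b = a \/ b = s a a.
Hypothesis irr : forall A : {set T}, (forall a b, a \in A -> b \notin A -> n a b = 0) ->
  A = set0 \/ A = setT.

(** The canonical invariant bilinear form of a root system. *)
Definition form a b : int := \sum_t n a t * n b t.

Lemma formC a b : form a b = form b a.
Proof. by apply: eq_bigr => t _; rewrite mulrC. Qed.

Lemma cartan_inv c a b : n (s c a) (s c b) = n a b.
Proof. by rewrite n_sl !n_sr n_diag; ring. Qed.

Lemma form_inv c a b : form (s c a) (s c b) = form a b.
Proof.
rewrite /form (reindex_inj (can_inj (sK c))) /=.
by apply: eq_bigr => t _; rewrite !cartan_inv.
Qed.

Lemma form_reflL a b c : form (s a b) c = form b c - n b a * form a c.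
Proof. by rewrite /form mulr_sumr -sumrB; apply: eq_bigr => t _; rewrite n_sl; ring. Qed.

Lemma form_cartan a b : 2 * form a b = n a b * form b b.
Proof.
have := form_inv b a b; rewrite form_reflL [form a _]formC [form b _]formC !form_reflL !n_diag [form b a]formC => e.
by clear -e; lia.
Qed.

Lemma form_gt0 a : 0 < form a a.
Proof.
rewrite /form (bigD1 a) //= n_diag ltr_pwDl // sumr_ge0 // => t _.
by rewrite -expr2 sqr_ge0.
Qed.

Lemma cartan_form_sym a b : n a b * form b b = n b a * form a a.
Proof. by rewrite -!form_cartan formC. Qed.

Lemma cartan_prod_le4 a b : n a b * n b a <= 4.
Proof.
have : 0 <= \sum_t (2 * n a t - n a b * n b t) ^+ 2 by apply: sumr_ge0 => t _; apply: sqr_ge0.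
have -> : \sum_t (2 * n a t - n a b * n b t) ^+ 2
   = 4 * form a a - 2 * n a b * (2 * form a b) + n a b * n a b * form b b.
  rewrite /form !mulr_sumr -sumrB -big_split; apply: eq_bigr => t _ /=; ring.
have := form_gt0 a; rewrite form_cartan => Ba.
have -> : 4 * form a a - 2 * n a b * (n a b * form b b) + n a b * n a b * form b b
  = (4 - n a b * n b a) * form a a.
  have -> : (4 - n a b * n b a) * form a a = 4 * form a a - n a b * (n b a * form a a) by ring.
  by rewrite -(cartan_form_sym a b); ring.
by rewrite pmulr_lge0 // subr_ge0.
Qed.

Lemma cartan_prod_eq4 a b : n a b * n b a = 4 -> b = a \/ b = s a a.
Proof.
move=> e; apply: proportional => t.
have : \sum_t (2 * n a t - n a b * n b t) ^+ 2 = 0.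
  have -> : \sum_t (2 * n a t - n a b * n b t) ^+ 2
     = 4 * form a a - 2 * n a b * (2 * form a b) + n a b * n a b * form b b.
    rewrite /form !mulr_sumr -sumrB -big_split; apply: eq_bigr => t' _ /=; ring.
  have -> : n a b * n a b * form b b = n a b * n b a * form a a by rewrite -mulrA cartan_form_sym; ring.
  have -> : 2 * n a b * (2 * form a b) = 2 * (n a b * n b a) * form a a.
    by rewrite form_cartan cartan_form_sym; ring.
  by rewrite e; ring.
move/eqP; rewrite psumr_eq0 => [|i _]; last exact: sqr_ge0.
by move/allP/(_ t (mem_index_enum _)); rewrite /= sqrf_eq0 subr_eq0 => /eqP.
Qed.

Inductive orb a : T -> Prop :=
  | orb0 : orb a a
  | orbS c e : orb a e -> orb a (s c e).

Lemma orb_form a e : orb a e -> form e e = form a a.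
Proof. by elim=> // c e' _; rewrite form_inv. Qed.

(** The roots that are orthogonal to the whole orbit of a are orthogonal to all the
other ones: if e is in the orbit and c is not orthogonal to e, then e and s_c e
differ by a nonzero multiple of c. *)
Lemma orb_meets a b : exists2 e, form e e = form a a & n e b != 0.
Proof.
pose A := [set c | `[< exists2 e, orb a e & n e c != 0 >]].
have [c d|A0|AT] := irr (A := A).
- rewrite !inE => /asboolP[e oe ec] /asboolPn no.
  have z e' : orb a e' -> n e' d = 0.
    by move=> oe'; apply: contrapT => /eqP h; apply: no; exists e'.
  have := z _ (orbS c oe); rewrite n_sl z // sub0r => /eqP.
  by rewrite oppr_eq0 mulf_eq0 (negPf ec) => /eqP.
- have : a \in A by rewrite inE; apply/asboolP; exists a; [exact: orb0 | rewrite n_diag].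
  by rewrite A0 inE.
have : b \in A by rewrite AT.
by rewrite inE => /asboolP[e /orb_form]; exists e.
Qed.

Lemma form_neg a : form (s a a) (s a a) = form a a. Proof. exact: form_inv. Qed.

(** The ratio of the norms of two roots that are neither orthogonal nor
proportional is the ratio of two integers of the same sign with product at
most 3. *)
Lemma ratio_arith (x y z m : int) : 0 < m -> m <= z -> x != 0 -> x * y < 4 ->
  x * z = y * m -> [\/ z = m, z = 2 * m | z = 3 * m].
Proof.
have core (u w : int) : 0 < m -> m <= z -> 0 < u -> u * w < 4 -> u * z = w * m ->
    [\/ z = m, z = 2 * m | z = 3 * m].
  move=> m0 mz u0 uw e.
  have uw' : u <= w.
    rewrite -(ler_pM2r m0) -e; clear -mz u0; nia.
  have u1 : u = 1 by clear -uw uw' u0; nia.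
  rewrite u1 !mul1r in e uw uw'.
  have [|[]] : w = 1 \/ w = 2 \/ w = 3 by clear -uw uw'; lia.
  - by move=> w1; apply: Or31; rewrite e w1 mul1r.
  - by move=> w1; apply: Or32; rewrite e w1.
  - by move=> w1; apply: Or33; rewrite e w1.
move=> m0 mz; case: (ltgtP x 0) => // x0 _ xy e; last exact: (core x y).
by apply: (core (- x) (- y)); rewrite ?oppr_gt0 ?mulrNN ?mulNr ?e.
Qed.

Lemma form_ratios a b (m : int) : 0 < m -> form a a = m -> m <= form b b ->
  [\/ form b b = m, form b b = 2 * m | form b b = 3 * m].
Proof.
move=> m0 Ba mb; have [e Be eb] := orb_meets a b.
have := cartan_prod_le4 e b; rewrite le_eqVlt => /predU1P[/cartan_prod_eq4[]-> | lt].
- by rewrite Be Ba; apply: Or31.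
- by rewrite form_neg Be Ba; apply: Or31.
have := cartan_form_sym e b; rewrite Be Ba => e1.
exact: (ratio_arith m0 mb eb lt e1).
Qed.

Theorem cartan_datum_of_irreducible : exists D : cartan_datum, exists v : droot D -> T,
  bijective v /\ forall a b, v (srefl a b) = s (v a) (v b).
Proof.
have [a0|T0] := pickP (fun _ : T => true); last first.
  have z (X : T -> Prop) a : X a by have := T0 a.
  unshelve eexists (@CartanDatum T n s (fun=> 1) 2 _ _ _ _ _ _ _ _ _ _).
  - by left.
  - by left.
  - exact: n_diag.
  - exact: n_sl.
  - exact: n_sr.
  - exact: sK.
  - by [].
  - by move=> a; have := T0 a.
  - by move=> I p x _ t; have := T0 t.
  - by move=> a; have := T0 a.
  by exists id; split=> //; exists id.
have [a1 _ Bmin] := @Order.TotalTheory.arg_minP _ _ _ a0 xpredT (fun a => form a a) isT.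
pose m := form a1 a1; have m0 : 0 < m by exact: form_gt0.
have mn0 : m != 0 by rewrite gt_eqF.
have rat b : [\/ form b b = m, form b b = 2 * m | form b b = 3 * m].
  by apply: (form_ratios (a := a1)) => //; apply: Bmin.
pose f b := (form b b %/ m)%Z.
have fE b : form b b = m * f b /\ [\/ f b = 1, f b = 2 | f b = 3].
  rewrite /f; case: (rat b) => ->; rewrite ?mulzK ?divzz ?mn0 //.
  - by rewrite mulr1; split=> //; apply: Or31.
  - by split; [rewrite mulrC | apply: Or32].
  - by split; [rewrite mulrC | apply: Or33].
(* The ratio 3/2 of squared lengths does not occur. *)
have no23 a b : f a = 2 -> f b = 3 -> False.
  move=> fa fb; have [e Be eb] := orb_meets a b.
  have := cartan_prod_le4 e b; have := cartan_form_sym e b.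
  rewrite Be (fE a).1 (fE b).1 fa fb => h; have {}h : n e b * 3 = n b e * 2.
    by apply: (mulIf mn0); move: h; clear; lia.
  by move: h eb; clear; nia.
have [k k23 f1k] : exists2 k : int, k = 2 \/ k = 3 & forall a, f a = 1 \/ f a = k.
  have [[b fb]|no3] := pselect (exists b, f b = 3).
    exists 3; [by right|] => a; case: (fE a).2 => fa; [by left| |by right].
    by case: (no23 _ _ fa fb).
  exists 2; [by left|] => a; case: (fE a).2 => fa; [by left|by right|].
  by case: no3; exists a.
have cartan_len_form a b : m * (n a b * f b) = 2 * form a b.
  by rewrite form_cartan (fE b).1; ring.
unshelve eexists (@CartanDatum T n s f k k23 f1k n_diag n_sl n_sr sK _ _ _ _).
- by move=> a b; rewrite /f form_inv.
- move=> a b; apply: (mulfI mn0).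
  by rewrite !cartan_len_form formC.
- move=> I p x le t.
  have e : m * (\sum_i \sum_j x i * x j * (n (p i) (p j) * f (p j))) =
      2 * \sum_u (\sum_i x i * n (p i) u) ^+ 2.
    pose y i u := x i * n (p i) u.
    transitivity (\sum_i \sum_u \sum_j 2 * (y i u * y j u)).
      rewrite mulr_sumr; apply: eq_bigr => i _; rewrite mulr_sumr exchange_big /=.
      apply: eq_bigr => j _; rewrite mulrCA cartan_len_form mulrCA !mulr_sumr.
      by apply: eq_bigr => u _; rewrite /y; ring.
    rewrite exchange_big mulr_sumr; apply: eq_bigr => u _ /=.
    rewrite expr2 mulr_suml mulr_sumr; apply: eq_bigr => i _.
    by rewrite !mulr_sumr.
  have : \sum_u (\sum_i x i * n (p i) u) ^+ 2 == 0.
    rewrite eq_le sumr_ge0 ?andbT => [|u _]; last exact: sqr_ge0.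
    by move: e m0 le; clear; nia.
  rewrite psumr_eq0 => [|i _]; last exact: sqr_ge0.
  by move/allP/(_ t (mem_index_enum _)); rewrite /= sqrf_eq0 => /eqP.
- exact: cartan_prod_eq4.
by exists id; split=> //; exists id.
Qed.
End Lengths.

(** * The Cartan datum of a reduced irreducible root system *)
Section NonzeroRoots.
Variables (F : fieldType) (V : vectType F) (R : root_system V).
Hypothesis charF0 : [pchar F]%R =i pred0.

Lemma natr_eq0F m : (m%:R == 0 :> F) = (m == 0)%N.
Proof. by move/GRing.pcharf0P: charF0 => ->. Qed.

Lemma intr_eq0F (z : int) : (z%:~R == 0 :> F) = (z == 0).
Proof.
case: z => m; first by rewrite natr_eq0F.
by rewrite NegzE rmorphN oppr_eq0 natr_eq0F.
Qed.

Lemma intr_injF (y z : int) : y%:~R = z%:~R :> F -> y = z.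
Proof.
by move/eqP; rewrite -subr_eq0 -rmorphB intr_eq0F subr_eq0 => /eqP.
Qed.

Lemma corootB a x y : coroot R a (x - y) = coroot R a x - coroot R a y.
Proof. exact: linearB. Qed.

Lemma corootD a x y : coroot R a (x + y) = coroot R a x + coroot R a y.
Proof. exact: linearD. Qed.

Lemma corootZ a k x : coroot R a (k *: x) = k * coroot R a x.
Proof. exact: linearZ. Qed.

Lemma mem_nzroots x : (x \in nzroots R) = (x != 0) && (x \in roots R).
Proof. by rewrite /nzroots in_fsetD1. Qed.

Definition refl_fun a (x : V) := x - coroot R a x *: a.

Lemma refl_funK a : a \in nzroots R -> involutive (refl_fun a).
Proof.
rewrite mem_nzroots => /andP[a0 aR] x.
rewrite /refl_fun corootB corootZ coroot_root // -addrA -opprD -scalerDl.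
set c := coroot R a x; have -> : c + (c - c * 2%:R) = 0 by ring.
by rewrite scale0r subr0.
Qed.

Lemma no_progression (x y : V) : (forall j : nat, x + y *+ j \in roots R) -> y = 0.
Proof.
move=> xy; apply: contrapT => /eqP y0.
pose g j := x + y *+ j; pose N := (size (enum_fset (roots R))).+1.
have gi : injective g.
  move=> i j /addrI /eqP; wlog le : i j / (i <= j)%N => [h e|].
    by case: (leqP i j) => [/h->//|/ltnW/h]; rewrite eq_sym => ->.
  rewrite eq_sym -subr_eq0 -mulrnBr // -scaler_nat scaler_eq0 (negPf y0) orbF natr_eq0F subn_eq0.
  by move=> le'; apply/eqP; rewrite eqn_leq le.
have : (size [seq g j | j <- iota 0 N] <= size (enum_fset (roots R)))%N.
  apply: uniq_leq_size; first by rewrite map_inj_uniq ?iota_uniq.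
  by move=> z /mapP[j _ ->]; exact: xy.
by rewrite size_map size_iota ltnn.
Qed.

(** The product of the two reflections defined by g and by the coroot of c is a
transvection, which would move a root x along an infinite progression unless
g and the coroot of c agree on x. *)
Lemma coroot_unique (g : V -> F) c : c \in nzroots R -> 
  (forall x (k : F) y, g (x - k *: y) = g x - k * g y) -> g c = 2%:R ->
  (forall x, x \in roots R -> x - g x *: c \in roots R) ->
  forall x, x \in roots R -> g x = coroot R c x.
Proof.
rewrite mem_nzroots => /andP[c0 cR] glin gc gR x xR.
pose h := coroot R c x - g x; apply/eqP; rewrite eq_sym -subr_eq0 -/h.
suff /eqP : (- h) *: c = 0 by rewrite scaler_eq0 oppr_eq0 (negPf c0) orbF.
apply: (@no_progression x) => j; elim: j => [|j IH]; first by rewrite addr0.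
have := root_refl cR c0 (gR _ IH); set z := x + _ in IH *.
have gz : g z = g x - j%:R * h * 2%:R.
  by rewrite /z -scaler_nat scalerA mulrN scaleNr glin gc.
have cz : coroot R c z = coroot R c x - j%:R * h * 2%:R.
  rewrite /z -scaler_nat scalerA mulrN scaleNr corootB corootZ coroot_root //.
rewrite corootB corootZ coroot_root // -addrA -opprD -scalerDl [_ *+ j.+1]mulrSr [x + (_ + _)]addrA -/z.
suff -> : g z + (coroot R c z - g z * 2%:R) = h by rewrite scaleNr.
by rewrite cz gz /h; ring.
Qed.

Lemma span_ind (P : V -> Prop) : P 0 ->
  (forall k a x, a \in roots R -> P x -> P (k *: a + x)) -> forall x, P x.
Proof.
move=> P0 PD x; have : x \in <<enum_fset (roots R)>>%VS by rewrite roots_span memvf.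
move/(@coord_span _ _ _ (in_tuple (enum_fset (roots R)))) => ->.
by elim/big_rec: _ => // i y _; apply: PD; apply: mem_nth; rewrite ltn_ord.
Qed.

Lemma refl_funB a x y : refl_fun a (x - y) = refl_fun a x - refl_fun a y.
Proof. by rewrite /refl_fun corootB scalerBl !opprB addrACA [RHS]addrACA [- y + _]addrC. Qed.

Lemma refl_funZ a k x : refl_fun a (k *: x) = k *: refl_fun a x.
Proof. by rewrite /refl_fun corootZ scalerBr scalerA. Qed.

Lemma refl_fun_roots a x : a \in nzroots R -> x \in roots R -> refl_fun a x \in roots R.
Proof. by rewrite mem_nzroots => /andP[a0 aR]; apply: root_refl. Qed.

Lemma refl_fun0 a : refl_fun a 0 = 0.
Proof. by rewrite /refl_fun linear0 scale0r subr0. Qed.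

Lemma refl_fun_nzroots a x : a \in nzroots R -> x \in nzroots R -> refl_fun a x \in nzroots R.
Proof.
move=> aR; rewrite !mem_nzroots => /andP[x0 xR]; rewrite refl_fun_roots // andbT.
by apply: contraNneq x0 => e; rewrite -(refl_funK aR x) e refl_fun0.
Qed.

Lemma coroot_refl_fun a b x : a \in nzroots R -> b \in nzroots R -> x \in roots R ->
  coroot R (refl_fun a b) x = coroot R b (refl_fun a x).
Proof.
move=> aR bR xR; rewrite -(@coroot_unique (fun y => coroot R b (refl_fun a y))) //.
- exact: refl_fun_nzroots.
- by move=> y k z; rewrite refl_funB refl_funZ corootB corootZ.
- by rewrite refl_funK //; apply: coroot_root; move: bR; rewrite mem_nzroots => /andP[].
move=> y yR; rewrite -[y in y - _](refl_funK aR) -refl_funZ -refl_funB.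
by apply: refl_fun_roots => //; apply: (refl_fun_roots bR); apply: refl_fun_roots.
Qed.

Lemma coroot_refl_funE a b x : a \in nzroots R -> b \in nzroots R ->
  coroot R (refl_fun a b) x = coroot R b (refl_fun a x).
Proof.
move=> aR bR; elim/span_ind: x => [|k r x rR IH]; first by rewrite refl_fun0 !linear0.
have {2}-> : k *: r + x = x - (- k) *: r by rewrite scaleNr opprK addrC.
by rewrite refl_funB refl_funZ corootD corootB !corootZ IH coroot_refl_fun //; ring.
Qed.

Notation T := (nzroots R : finType).

Lemma nzP (a : T) : val a \in nzroots R. Proof. exact: fsvalP. Qed.

Lemma nz_root (a : T) : val a \in roots R.
Proof. by have := nzP a; rewrite mem_nzroots => /andP[]. Qed.

Lemma nz_neq0 (a : T) : val a != 0.
Proof. by have := nzP a; rewrite mem_nzroots => /andP[]. Qed.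

Definition nz_cartan (a b : T) : int :=
  projT1 (cid (coroot_int (nz_root b) (nz_neq0 b) (nz_root a))).

Lemma nz_cartanE a b : coroot R (val b) (val a) = (nz_cartan a b)%:~R.
Proof. by rewrite /nz_cartan; case: cid. Qed.

Definition nz_refl (a b : T) : T := FSetSub (refl_fun_nzroots (nzP a) (nzP b)).

Lemma val_nz_refl a b : val (nz_refl a b) = refl_fun (val a) (val b). Proof. by []. Qed.

Lemma nz_cartan_diag a : nz_cartan a a = 2.
Proof.
by apply: intr_injF; rewrite -nz_cartanE coroot_root ?nz_root ?nz_neq0.
Qed.

Lemma nz_cartan_reflL a b c : nz_cartan (nz_refl a b) c = nz_cartan b c - nz_cartan b a * nz_cartan a c.
Proof.
by apply: intr_injF; rewrite rmorphB rmorphM /= -!nz_cartanE val_nz_refl /refl_fun corootB corootZ.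
Qed.

Lemma nz_cartan_reflR a b c : nz_cartan c (nz_refl a b) = nz_cartan c b - nz_cartan a b * nz_cartan c a.
Proof.
apply: intr_injF; rewrite rmorphB rmorphM /= -!nz_cartanE val_nz_refl coroot_refl_fun ?nzP ?nz_root //.
by rewrite /refl_fun corootB corootZ mulrC.
Qed.

Lemma nz_reflK a : involutive (nz_refl a).
Proof. by move=> b; apply: val_inj; rewrite /= refl_funK ?nzP. Qed.

Hypothesis redR : reduced R.

(** Here 2 a - z b, with z the Cartan integer of a and b, is killed by both coroots;
then the product of the two reflections translates a by this vector, and
finiteness makes it vanish.  Reducedness leaves z = 2 or z = -2. *)
Lemma nz_cartan_proportional a b : (forall t, 2 * nz_cartan a t = nz_cartan a b * nz_cartan b t) ->
  b = a \/ b = nz_refl a a.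
Proof.
move=> ab; set z := nz_cartan a b in ab.
pose y := 2%:R *: val a - z%:~R *: val b.
have ya : coroot R (val a) y = 0.
  rewrite /y corootB !corootZ !nz_cartanE; apply/eqP; rewrite -[2%:R]/(2%:~R) -!intrM -rmorphB /= intr_eq0F subr_eq0.
  by rewrite ab.
have yb : coroot R (val b) y = 0.
  rewrite /y corootB !corootZ !nz_cartanE; apply/eqP; rewrite -[2%:R]/(2%:~R) -!intrM -rmorphB /= intr_eq0F subr_eq0.
  by rewrite ab.
have y0 : y = 0.
  apply: (@no_progression (val a)) => j; elim: j => [|j IH]; first by rewrite addr0 nz_root.
  have := refl_fun_roots (nzP a) (refl_fun_roots (nzP b) IH).
  rewrite mulrSr [val a + (_ + _)]addrA; set x := val a + y *+ j.
  have xa : coroot R (val a) x = 2%:R.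
    rewrite /x corootD raddfMn /= ya mul0rn addr0 coroot_root ?nz_root ?nz_neq0 //.
  have xb : coroot R (val b) x = z%:~R.
    by rewrite /x corootD raddfMn /= yb mul0rn addr0 nz_cartanE.
  have e : coroot R (val a) (z%:~R *: val b) = 4%:R.
    by rewrite corootZ nz_cartanE -intrM -ab nz_cartan_diag.
  rewrite {2}/refl_fun xb /refl_fun corootB xa e.
  suff -> : x - z%:~R *: val b - (2%:R - 4%:R) *: val a = x + y by [].
  have -> : 2%:R - 4%:R = - 2%:R :> F by ring.
  by rewrite scaleNr opprK /y [X in _ = _ + X]addrC addrA.
have two : 2%:R != 0 :> F by rewrite natr_eq0F.
have e : val a = (z%:~R / 2%:R) *: val b.
  apply: (scalerI two); rewrite scalerA mulrCA divff // mulr1.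
  by apply/eqP; rewrite -subr_eq0 -/y y0.
have := redR (nzP b) (k := z%:~R / 2%:R); rewrite -e => /(_ (nzP a)) kk.
case: kk e => -> e; [left|right]; apply: val_inj; first by rewrite e scale1r.
rewrite val_nz_refl /refl_fun nz_cartanE nz_cartan_diag [in RHS]e scaleN1r !scalerN opprK.
by rewrite scaler_nat mulr2n addKr.
Qed.

Hypothesis irrR : irreducible R.

Lemma nz_cartan_irr (A : {set T}) : (forall a b, a \in A -> b \notin A -> nz_cartan a b = 0) ->
  A = finset.set0 \/ A = finset.setTfor T.
Proof.
move=> Aorth; pose inA x := [exists a in A, val a == x].
have inAE (a : T) : inA (val a) = (a \in A).
  by apply/exists_inP/idP => [[b bA /eqP/val_inj<-]|aA] //; exists a.
pose P := [fset x in nzroots R | inA x]%fset.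
have inP x : (x \in P) = (x \in nzroots R) && inA x.
  by rewrite in_fset.
have [||a b|P0|Q0] := @irrR P (nzroots R `\` P)%fset.
- apply/fsetP => x; rewrite in_fsetU in_fsetD inP.
  by case: (x \in nzroots R); case: (inA x).
- by apply/fdisjointP => x xP; rewrite in_fsetD xP.
- rewrite in_fsetD !inP => /andP[aR aA] /andP[bA bR]; rewrite bR /= in bA.
  have Aa : FSetSub aR \in A by rewrite -inAE.
  have Ab : FSetSub bR \notin A by rewrite -inAE.
  have := Aorth _ _ Aa Ab; set a' := FSetSub aR; set b' := FSetSub bR => e.
  have e' : nz_cartan b' a' = 0.
    have := cartan_form_sym nz_cartan_diag nz_cartan_reflL nz_cartan_reflR nz_reflK a' b'; rewrite e mul0r => /esym/eqP.
    by rewrite mulf_eq0 (gt_eqF (form_gt0 nz_cartan_diag _)) orbF => /eqP.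
  by split; rewrite -[a]/(val a') -[b]/(val b') nz_cartanE ?e ?e'.
- left; apply/setP => a; rewrite [RHS]inE; apply/negbTE/negP => aA.
  by have := in_fset0 (val a); rewrite -P0 inP nzP inAE aA.
right; apply/setP => a; rewrite [RHS]inE; apply: contraT => aA.
by have := in_fset0 (val a); rewrite -Q0 in_fsetD inP nzP inAE aA.
Qed.

Theorem cartan_datum_exists : exists (D : cartan_datum) (v : droot D -> V),
  [/\ injective v, forall x, (x \in nzroots R) <-> (exists a, v a = x) &
     forall a b, v (srefl a b) = refl_fun (v a) (v b)].
Proof.
have [D [v [vbij vs]]] := cartan_datum_of_irreducible nz_cartan_diag nz_cartan_reflL nz_cartan_reflR nz_reflK nz_cartan_proportional nz_cartan_irr.
exists D, (fun a => val (v a)); split=> [a b /val_inj/(bij_inj vbij)//|x|a b].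
- split=> [xR|[a <-]]; last exact: nzP.
  by have [v' _ vK] := vbij; exists (v' (FSetSub xR)); rewrite vK.
by rewrite vs.
Qed.

End NonzeroRoots.

(** * Words in reflections *)

(** In Smith normal form the row of index k vanishes. *)
Lemma int_left_kernel m k (A : 'M[int]_(m, k)) : (k < m)%N ->
  exists2 u : 'rV[int]_m, u != 0 & u *m A = 0.
Proof.
move=> km; have [L uL [K _ [d _ ->]]] := int_Smith_normal_form A.
exists (row (Ordinal km) (invmx L)).
  apply/eqP => /(congr1 (fun x => x *m L)); rewrite -row_mul mulVmx // mul0mx.
  by move/rowP/(_ (Ordinal km)); rewrite !mxE eqxx.
rewrite -row_mul mulmxA mulKmx // row_mul [X in X *m _](_ : _ = 0) ?mul0mx //.
apply/rowP => j; rewrite !mxE /= gtn_eqF ?mulr0n //; exact: ltn_ord.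
Qed.

Section Words.
Variables (F : fieldType) (V : vectType F) (R : root_system V).
Hypothesis charF0 : [pchar F]%R =i pred0.
Implicit Types (P : {fset V}) (ps : seq V).
Local Notation rfl := (refl_fun R).
Local Notation nz := (nzroots R).

Lemma reflectionE a x : reflection R a x = rfl a x.
Proof.
have lin : linear (rfl a).
  move=> k y z; have -> : k *: y + z = z - (- k) *: y by rewrite scaleNr opprK addrC.
  by rewrite refl_funB refl_funZ scaleNr opprK addrC.
pose f : {linear V -> V} := HB.pack (rfl a) (GRing.isLinear.Build F V V *:%R (rfl a) lin).
exact: (lfunE f x).
Qed.

Definition wact ps x := foldl (fun y p => rfl p y) x ps.

Definition over P ps := {in ps, forall p, p \in P}.

Definition words P : set 'End(V) := [set f | exists2 ps, over P ps & forall x, f x = wact ps x].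

Lemma wact_cat ps qs x : wact (ps ++ qs) x = wact qs (wact ps x).
Proof. exact: foldl_cat. Qed.

Lemma wact_rev P ps : (P `<=` nz)%fset -> over P ps -> cancel (wact ps) (wact (rev ps)).
Proof.
move=> /fsubsetP Pn; elim: ps => //= p ps IH Pps x.
rewrite rev_cons -cats1 wact_cat /= IH => [|q qps]; last by apply: Pps; rewrite inE qps orbT.
by rewrite refl_funK // Pn // Pps // inE eqxx.
Qed.

Lemma over_rev P ps : over P ps -> over P (rev ps).
Proof. by move=> h p; rewrite mem_rev; apply: h. Qed.

Lemma over_cat P ps qs : over P ps -> over P qs -> over P (ps ++ qs).
Proof. by move=> h h' p; rewrite mem_cat => /orP[/h|/h']. Qed.

Lemma over1 P p : p \in P -> over P [:: p].
Proof. by move=> pP q; rewrite inE => /eqP->. Qed.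

Lemma words_group P : (P `<=` nz)%fset -> is_subgroup (words P).
Proof.
move=> Pn; have inj f : words P f -> lker f == 0%VS.
  case=> ps Pps fE; apply/lker0P => x y; rewrite !fE => e.
  by rewrite -[x](wact_rev Pn Pps) e (wact_rev Pn Pps).
split=> // [|f g [ps Pps fE] [qs Pqs gE]|f Hf].
- by exists [::] => // x; rewrite id_lfunE.
- by exists (qs ++ ps); [exact: over_cat | move=> x; rewrite lfunE /= fE gE wact_cat].
have [ps Pps fE] := Hf; exists (rev ps); first exact: over_rev.
move=> x; have e : f (wact (rev ps) x) = x.
  by rewrite fE -{1}[ps]revK (wact_rev Pn) //; exact: over_rev.
by rewrite -{1}e lker0_lfunK // inj.
Qed.

Fixpoint wend ps : 'End(V) := if ps is p :: ps' then (wend ps' \o reflection R p)%VF else \1%VF.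

Lemma wendE ps x : wend ps x = wact ps x.
Proof.
elim: ps x => [|p ps IH] x /=; first by rewrite id_lfunE.
by rewrite lfunE /= IH reflectionE.
Qed.

Lemma weyl_subE P : (P `<=` nz)%fset -> weyl_sub R P = words P.
Proof.
move=> Pn; apply/seteqP; split.
  apply: smallest_sub; first exact: words_group.
  move=> _ [p pP <-]; exists [:: p]; first exact: over1.
  by move=> x; rewrite reflectionE.
move=> f [ps Pps fE] H [[Hid _ Hc _] HP].
have -> : f = wend ps by apply/lfunP => x; rewrite fE wendE.
elim: ps Pps {fE} => //= p ps IH Pps; apply: Hc.
  by apply: IH => q qps; apply: Pps; rewrite inE qps orbT.
by apply: HP; exists p => //; apply: Pps; rewrite inE eqxx.
Qed.

Lemma reflection_word P a : (P `<=` nz)%fset ->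
  weyl_sub R P (reflection R a) <-> exists2 ps, over P ps & forall x, rfl a x = wact ps x.
Proof.
move=> Pn; rewrite weyl_subE //; split=> -[ps Pps e]; exists ps => // x.
  by rewrite -e reflectionE.
by rewrite reflectionE.
Qed.

Lemma generatingP P : (P `<=` nz)%fset ->
  weyl_sub R P = weyl R <-> forall a, a \in nz -> weyl_sub R P (reflection R a).
Proof.
move=> Pn; split=> [-> a anz|h].
  by apply: sub_gen_smallest; exists a.
have sub Q : (Q `<=` nz)%fset -> is_subgroup (weyl_sub R Q).
  by move=> Qn; rewrite weyl_subE //; apply: words_group.
apply/seteqP; split; apply: smallest_sub.
- exact: sub.
- by move=> _ [p pP <-]; apply: sub_gen_smallest; exists p => //; exact: (fsubsetP Pn).
- exact: sub.
by move=> _ [p pn <-]; apply: h.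
Qed.

Lemma orbitE P x : (P `<=` nz)%fset ->
  weyl_orbit R P x <-> exists2 ps, over P ps & exists2 p, p \in P & x = wact ps p.
Proof.
move=> Pn; rewrite /weyl_orbit weyl_subE //; split.
  by case=> f [ps Pps fE] [p pP <-]; exists ps => //; exists p.
case=> ps Pps [p pP ->]; exists (wend ps); first by exists ps => // y; exact: wendE.
by exists p => //; exact: wendE.
Qed.

Lemma refl_fun_refl_fun q a x : q \in nz -> a \in nz -> rfl (rfl q a) x = rfl q (rfl a (rfl q x)).
Proof.
move=> qn an; have -> : rfl a (rfl q x) = rfl q x - coroot R a (rfl q x) *: a by [].
by rewrite refl_funB refl_funZ refl_funK // /refl_fun coroot_refl_funE.
Qed.

Lemma wact_nz P ps x : (P `<=` nz)%fset -> over P ps -> x \in nz -> wact ps x \in nz.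
Proof.
move=> /fsubsetP Pn; elim: ps x => //= p ps IH x Pps xn; apply: IH.
  by move=> q qps; apply: Pps; rewrite inE qps orbT.
by apply: refl_fun_nzroots => //; apply/Pn/Pps; rewrite inE eqxx.
Qed.

Lemma wact_refl_fun P ps p x : (P `<=` nz)%fset -> over P ps -> p \in nz ->
  rfl (wact ps p) x = wact (rev ps ++ p :: ps) x.
Proof.
move=> Pn; elim: ps p x => //= q ps IH p x Pps pn.
have qn : q \in nz by apply/(fsubsetP Pn)/Pps; rewrite inE eqxx.
have Pps' : over P ps by move=> q' qps; apply: Pps; rewrite inE qps orbT.
rewrite IH ?refl_fun_nzroots // rev_cons -cats1 -catA /= !wact_cat /=.
by rewrite refl_fun_refl_fun.
Qed.

Lemma orbit_generating P : (P `<=` nz)%fset ->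
  weyl_orbit R P = [set` nz]%classic -> weyl_sub R P = weyl R.
Proof.
move=> Pn oP; apply/generatingP => // a an; apply/reflection_word => //.
have : weyl_orbit R P a by rewrite oP.
case/orbitE => // ps Pps [p pP ->]; exists (rev ps ++ p :: ps).
  by apply: over_cat; [exact: over_rev | rewrite -cat1s; apply: over_cat => //; exact: over1].
by move=> x; apply: (wact_refl_fun _ Pn) => //; exact: (fsubsetP Pn).
Qed.

Section Transport.
Variables (D : cartan_datum) (v : droot D -> V).
Hypothesis v_inj : injective v.
Hypothesis v_nz : forall x, (x \in nz) <-> (exists a, v a = x).
Hypothesis v_s : forall a b, v (srefl a b) = rfl (v a) (v b).

Lemma v_eq a b : (v a == v b) = (a == b). Proof. exact: inj_eq. Qed.

Lemma v_mem a : v a \in nz. Proof. by apply/v_nz; exists a. Qed.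

Lemma v_act (ps : seq (droot D)) a : v (act ps a) = wact (map v ps) (v a).
Proof. by elim: ps a => //= p ps IH a; rewrite -v_s -IH. Qed.

Lemma lift_word P ps : (P `<=` nz)%fset -> over P ps -> exists ps' : seq (droot D), ps = map v ps'.
Proof.
move=> /fsubsetP Pn; elim: ps => [|p ps IH] Pps; first by exists [::].
have [ps' ->] := IH (fun q qps => Pps q (mem_behead (s := p :: ps) qps)).
have [p' e] : exists p', v p' = p by apply/v_nz/Pn/Pps; rewrite inE eqxx.
by exists (p' :: ps'); rewrite /= e.
Qed.

(** When W_P = W, the complement of the orbit of P is stable under all reflections;
a root in it would have a reflection that is a word in the reflections of P,
which lie outside it. *)
Lemma generating_orbit P : (P `<=` nz)%fset ->
  weyl_sub R P = weyl R -> weyl_orbit R P = [set` nz]%classic.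
Proof.
move=> Pn gP; apply/seteqP; split=> x.
  case/orbitE => // ps Pps [p pP ->] /=; apply: (wact_nz Pn) => //; exact: (fsubsetP Pn).
move=> /= xn; apply: contrapT => nx.
have [a e] := (v_nz x).1 xn; rewrite -{x xn}e in nx.
pose B := finset.setC [set b | `[< weyl_orbit R P (v b) >]]%SET.
have BP b : reflect (~ weyl_orbit R P (v b)) (b \in B).
  by rewrite finset.in_setC finset.in_set; exact: asboolPn.
have Bst p b : b \in B -> srefl p b \in B.
  move=> /BP nb; apply/BP => ob; apply: nb.
  have := (generatingP Pn).1 gP _ (v_mem p); case/reflection_word => // qs Pqs qE.
  have [ps Pps [q qP e]] := (orbitE _ Pn).1 ob; apply/(orbitE _ Pn).
  exists (ps ++ qs); first exact: over_cat.
  by exists q => //; rewrite wact_cat -e -qE v_s refl_funK // v_mem.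
have := (generatingP Pn).1 gP _ (v_mem a); case/reflection_word => // ps Pps pE.
have [ps' e] := lift_word Pn Pps.
apply: (@reflection_not_word D B Bst ps' a).
- move=> p pps; apply/negP => /BP; apply.
  apply/(orbitE _ Pn); exists [::] => //; exists (v p) => //.
  by apply: Pps; rewrite e map_f.
- exact/BP.
by move=> b; apply: v_inj; rewrite v_act -e v_s pE.
Qed.

Lemma rclosure_reflection P (Q : {set droot D}) a : (P `<=` nz)%fset -> (forall b, b \in Q -> v b \in P) ->
  rclosure (@srefl D) Q a -> weyl_sub R P (reflection R (v a)).
Proof.
move=> Pn QP; elim=> [b bQ|b c _ IHb _ IHc].
  by apply: sub_gen_smallest; exists (v b) => //; apply: QP.
move: IHb IHc => /(reflection_word _ Pn)[ps Pps pE] /(reflection_word _ Pn)[qs Pqs qE].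
apply/reflection_word => //; exists (ps ++ qs ++ ps); first by do 2 apply: over_cat => //.
by move=> x; rewrite !wact_cat -pE -qE -pE v_s refl_fun_refl_fun ?v_mem.
Qed.

Definition pull P : {set droot D} := [set a | v a \in P]%SET.

(** A root that the closure of the other ones contains can be left out. *)
Lemma minimal_independent P (x : droot D -> int) : minimal_generating R P ->
  (forall b, x b != 0 -> v b \in P) -> (forall t, \sum_b x b * cartan b t = 0) ->
  forall b, x b = 0.
Proof.
move=> [Pn gP Pmin] supp rel b; apply: contrapT => /eqP xb.
have [||a aP ca] := @dependent_redundant D (pull P) x rel.
- by exists b.
- by move=> c /supp; rewrite inE.
rewrite inE in aP.
have P'n : (P `\ v a `<=` nz)%fset by apply: fsubset_trans Pn; apply: fsubD1set.
apply: (Pmin (P `\ v a)%fset); first by rewrite fproperD1.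
have P'sub : is_subgroup (weyl_sub R (P `\ v a)%fset).
  by rewrite weyl_subE //; apply: words_group.
apply/generatingP => // c cn; have : weyl_sub R P (reflection R c) by exact: (generatingP Pn).1 gP _ cn.
move: (reflection R c); apply: smallest_sub => // _ [p pP <-].
have [->|pa] := eqVneq p (v a).
  by apply: (rclosure_reflection P'n _ ca) => d; rewrite in_setD1 in_fsetD1 inE v_eq.
by apply: sub_gen_smallest; exists p => //=; rewrite in_fsetD1 pa.
Qed.

Lemma generating_span P a : (P `<=` nz)%fset -> weyl_sub R P = weyl R ->
  exists2 x : droot D -> int, (forall b, b \notin pull P -> x b = 0) &
    forall t, cartan a t = \sum_b x b * cartan b t.
Proof.
move=> Pn gP; have : weyl_orbit R P (v a) by rewrite generating_orbit //=; exact: v_mem.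
pose sp b := exists2 x : droot D -> int, (forall c, c \notin pull P -> x c = 0) &
    forall t, cartan b t = \sum_c x c * cartan c t.
case/orbitE => // ps Pps [p pP e].
have [ps' psE] := lift_word Pn Pps.
have [p' pE] : exists p', v p' = p by apply/v_nz/(fsubsetP Pn).
have aE : a = act ps' p' by apply: v_inj; rewrite v_act -psE pE.
have : sp p'.
  exists (fun b => (b == p')%:R) => [b|t].
    by rewrite inE; case: eqP => // ->; rewrite pE pP.
  rewrite (bigD1 p') //= eqxx mul1r big1 ?addr0 // => b /negPf->; exact: mul0r.
have : {in ps', forall q, q \in pull P}.
  by move=> q qps; rewrite inE; apply: Pps; rewrite psE map_f.
rewrite aE; elim: ps' p' {psE pE aE} => //= q ps' IH p' qs [x x0 xE]; apply: IH.
  by move=> r rps; apply: qs; rewrite inE rps orbT.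
have qP : q \in pull P by apply: qs; rewrite inE eqxx.
exists (fun b => x b - (b == q)%:R * cartan p' q) => [b bP|t].
  by rewrite x0 //; case: eqP bP => [->|]; rewrite ?qP // mul0r subr0.
rewrite cartan_reflL xE; under [RHS]eq_bigr do rewrite mulrBl.
rewrite sumrB; congr (_ - _); rewrite (bigD1 q) //= eqxx mul1r big1 ?addr0 //.
by move=> b /negPf->; rewrite !mul0r.
Qed.

Lemma card_pull P : (P `<=` nz)%fset -> #|pull P| = #|` P|%fset.
Proof.
move=> /fsubsetP Pn; rewrite cardE -(size_map v); apply/perm_size/uniq_perm.
- by rewrite map_inj_uniq ?enum_uniq.
- exact: fset_uniq.
move=> x; apply/mapP/idP => [[a]|xP]; first by rewrite mem_enum inE => aP ->.
have [a e] := (v_nz x).1 (Pn _ xP); exists a => //.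
by rewrite mem_enum inE e.
Qed.

(** Express the roots of P by those of P' with integral coefficients: if P' had
fewer elements, the matrix of coefficients would have a left null vector,
which is a relation on P. *)
Lemma independent_card P P' : (P `<=` nz)%fset -> (P' `<=` nz)%fset ->
  (forall x : droot D -> int, (forall b, x b != 0 -> v b \in P) ->
    (forall t, \sum_b x b * cartan b t = 0) -> forall b, x b = 0) ->
  weyl_sub R P' = weyl R -> (#|` P| <= #|` P'|)%N.
Proof.
move=> Pn P'n ind gP'; rewrite -!card_pull //.
rewrite leqNgt; apply/negP => lt.
have /choice[X XE] a : exists x : droot D -> int, (forall b, b \notin pull P' -> x b = 0) /\
    forall t, cartan a t = \sum_b x b * cartan b t.
  by have [x x0 xE] := generating_span a P'n gP'; exists x.
pose A : 'M[int]_(#|pull P|, #|pull P'|) :=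
  \matrix_(i, j) X (enum_val i) (enum_val j).
have [u u0 uA] := int_left_kernel A lt.
pose x a : int := \sum_i u 0 i * (enum_val i == a)%:R.
have xev i : x (enum_val i) = u 0 i.
  rewrite /x (bigD1 i) //= eqxx mulr1 big1 ?addr0 // => j ji.
  by rewrite (inj_eq enum_val_inj) (negPf ji) mulr0.
case/eqP: u0; apply/rowP => i; rewrite mxE -xev; apply: ind => [b|t].
  apply: contraNT => bP; rewrite /x big1 // => j _.
  case: eqP => [e|]; last by rewrite mulr0.
  by have := enum_valP j; rewrite e inE (negPf bP).
transitivity (\sum_i u 0 i * cartan (enum_val i) t).
  rewrite /x; under eq_bigr do rewrite mulr_suml.
  rewrite exchange_big; apply: eq_bigr => j _ /=.
  rewrite (bigD1 (enum_val j)) //= eqxx mulr1 big1 ?addr0 // => b /negPf bj.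
  by rewrite eq_sym bj mulr0 mul0r.
transitivity (\sum_i \sum_j u 0 i * A i j * cartan (enum_val j) t).
  apply: eq_bigr => j _; have [X0 XEt] := XE (enum_val j).
  rewrite XEt (bigID (mem (pull P'))) /= [X in _ + X]big1 ?addr0 => [|b bP]; last first.
    by rewrite X0 // mul0r.
  rewrite big_enum_val mulr_sumr; apply: eq_bigr => l _.
  by rewrite mxE mulrA.
rewrite exchange_big big1 //= => j _; rewrite -mulr_suml.
by have /rowP/(_ j) := uA; rewrite !mxE => ->; rewrite mul0r.
Qed.
End Transport.

End Words.

(** * Comparison of the three classes *)
Section Counting.
Variables (F : fieldType) (V : vectType F) (R : root_system V).
Implicit Types P : {fset V}.
Local Notation nz := (nzroots R).

Lemma reflections_imfset P : ([set` [fset reflection R a | a in P]%fset] = reflections R P)%classic.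
Proof.
apply/seteqP; split=> f /=; first by case/imfsetP=> a aP ->; exists a.
by case=> a aP <-; apply/imfsetP; exists a.
Qed.

Lemma generated_imfset P : (P `<=` nz)%fset -> weyl_sub R P = weyl R ->
  generated_by_reflections R #|` [fset reflection R a | a in P]%fset|.
Proof.
move=> /fsubsetP Pn gP; exists [fset reflection R a | a in P]%fset; split=> //.
  by rewrite reflections_imfset => f [a aP <-]; exists a => //; apply: Pn.
by rewrite reflections_imfset.
Qed.

(** Choose one root for each of the m reflections. *)
Lemma generated_cover m : generated_by_reflections R m ->
  exists P, [/\ (P `<=` nz)%fset, weyl_sub R P = weyl R & (#|` P| <= m)%N].
Proof.
case=> S [Sn <- gS].
have /choice[g gE] f : exists a, f \in S -> a \in nz /\ reflection R a = f.
  have [fS|nfS] := boolP (f \in S); last by exists 0.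
  by have [a an e] := Sn f fS; exists a.
exists [fset g f | f in S]%fset; split; last exact: leq_imfset_card.
  by apply/fsubsetP => _ /imfsetP[f fS ->]; case: (gE _ fS).
rewrite -gS; congr generated; apply/seteqP; split=> f.
  by case=> _ /imfsetP[f' f'S ->] <-; rewrite (gE _ f'S).2.
move=> fS; exists (g f); last by case: (gE _ fS).
by apply/imfsetP; exists f.
Qed.
End Counting.

Theorem proposition3p2p2 (F : fieldType) (V : vectType F) (R : root_system V)
    (charF0 : [pchar F]%R =i pred0)
    (redR : reduced R) (irrR : irreducible R) :
  minimum_generating R = minimal_generating R /\
  minimal_generating R = reflectable_bases R.
Proof.
have [D [v [v_inj v_nz v_s]]] := cartan_datum_exists charF0 redR irrR.
have sub P P' : (P `<=` nzroots R)%fset -> (P' `<` P)%fset -> (P' `<=` nzroots R)%fset.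
  by move=> Pn /fproper_sub P'P; apply: fsubset_trans Pn.
split; apply/seteqP; split=> P [Pn gP].
- case=> _ least; split=> // P' P'P gP'.
  have := least _ (generated_imfset (sub _ _ Pn P'P) gP'); rewrite leqNgt => /negP; apply.
  by apply: leq_ltn_trans (leq_imfset_card _ _ _) _; apply: fproper_ltn_card.
- move=> Pmin; split=> //.
  have lower m : generated_by_reflections R m -> (#|` P| <= m)%N.
    case/generated_cover=> P' [P'n gP' le]; apply: leq_trans le.
    apply: (independent_card v_inj v_nz v_s Pn P'n _ gP').
    by move=> x; apply: (minimal_independent charF0 v_inj v_nz v_s); split.
  split=> //; have gS := generated_imfset Pn gP.
  suff <- : #|` [fset reflection R a | a in P]%fset| = #|` P| by [].
  by apply/eqP; rewrite eqn_leq lower // leq_imfset_card.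
- move=> Pmin; split=> //; first exact: (generating_orbit v_inj v_nz v_s).
  move=> P' P'P oP'; apply: (Pmin _ P'P).
  exact: (orbit_generating charF0 (sub _ _ Pn P'P)).
move=> Pmin; split=> //; first exact: (orbit_generating charF0).
move=> P' P'P gP'; apply: (Pmin _ P'P).
exact: (generating_orbit v_inj v_nz v_s (sub _ _ Pn P'P)).
Qed.
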